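(* Let $\Bbbk$ be a field. There is a natural equivalence between (1) the category of finite dimensional trident algebras $(A,M,f,g)$ over $\Bbbk$, and (2) the category of $\mathcal{C}om$-augmented operads over $\Bbbk$ of Gelfand-Kirillov dimension $3$.
   Context: **Operads.** An operad $\mathcal{P}$ is a symmetric operad in $\Bbbk$-vector spaces: right $\Bbbk\mathbb{S}_n$-modules $\mathcal{P}(n)$ ($n\ge 0$; action denoted $*$), an identity $\mathbb{1}=\mathbb{1}_1\in\mathcal{P}(1)$, and partial compositions $\circ_i:\mathcal{P}(m)\otimes\mathcal{P}(n)\to\mathcal{P}(m+n-1)$ ($1\le i\le m$, $n\ge 0$) satisfying the usual identity, associativity and equivariance axioms. All operads are locally finite: $\dim_{\Bbbk}\mathcal{P}(n)<\infty$ for all $n$. An operad is unitary if $\mathcal{P}(0)=\Bbbk\mathbb{1}_0$ is one-dimensional with a chosen basis element $\mathbb{1}_0$ (the $0$-unit); morphisms of unitary operads preserve $0$-units. The Gelfand-Kirillov dimension is $\operatorname{GKdim}\mathcal{P}=\limsup_{n\to\infty}\log_n\left(\sum_{i=0}^n\dim_{\Bbbk}\mathcal{P}(i)\right)$. $\mathcal{C}om$ is the operad with $\mathcal{C}om(n)=\Bbbk\mathbb{1}_n$ for all $n\ge0$, trivial symmetric group actions and $\mathbb{1}_m\circ_i\mathbb{1}_n=\mathbb{1}_{m+n-1}$. A $\mathcal{C}om$-augmented operad is a unitary operad $\mathcal{P}$ together with a morphism of unitary operads $u_{\mathcal{P}}:\mathcal{C}om\to\mathcal{P}$. A morphism of $\mathcal{C}om$-augmented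 operads $\mathcal{P}\to\mathcal{P}'$ is an operad morphism $\gamma$ with $\gamma u_{\mathcal{P}}=u_{\mathcal{P}'}$. **Trident algebras.** A trident algebra (in the form of a trident system) is a quadruple $(A,M,f,g)$ where: (1) $A=\Bbbk 1_A\oplus\bar A$ is an augmented unital associative $\Bbbk$-algebra with augmentation ideal $\bar A$; (2) $M\neq0$ is an $(A,A\otimes A)$-bimodule (left $A$-, right $A\otimes A$-module) which is also a right $\Bbbk\mathbb{S}_2$-module (action $*$) such that $a(\mu*(12))=(a\mu)*(12)$ and $(\mu\cdot(a\otimes b))*(12)=(\mu*(12))\cdot(b\otimes a)$ for all $a,b\in A$, $\mu\in M$; (3) $f:\bar A\to M$ is a $\Bbbk$-linear map with $f(a)*(12)=f(a)$ for all $a\in\bar A$; (4) $g:\bar A\otimes\bar A\to M$ is a homomorphism of right $A\otimes A$-modules with $g(a,b)*(12)=g(b,a)$ for all $a,b\in\bar A$; and for all $a,b,c\in\bar A$: $$f(ab)=af(b)+f(a)\cdot(b\otimes1_A)+f(a)\cdot(1_A\otimes b)+g(a,b)+g(b,a),$$ $$f(a)\cdot(b\otimes c)=a\,g(b,c)-g(ab,c)-g(b,ac).$$ It is finite dimensional if $A$ and $M$ are finite dimensional over $\Bbbk$. A morphism $(A,M,f,g)\to(A',M',f',g')$ is a pair $(\alpha,\beta)$ where $\alpha:A\to A'$ is a homomorphism of augmented algebras and $\beta:M\to M'$ is a $\Bbbk\mathbb{S}_2$-linear homomorphism of $(A,A\otimes A)$-bimodules ($M'$ being regarded as such via $\alpha$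 and $\alpha\otimes\alpha$), with $\beta f=f'\alpha|_{\bar A}$ and $\beta g=g'(\alpha\otimes\alpha)|_{\bar A\otimes\bar A}$. *)

(* Defs.v *)
From HB Require Import structures.
From mathcomp Require Import all_boot all_order all_fingroup all_algebra all_field.
From mathcomp Require Import zify.
From mathcomp Require Import all_classical all_reals all_analysis.

Set Implicit Arguments.
Unset Strict Implicit.
Unset Printing Implicit Defensive.

Import Order.TTheory GRing.Theory Num.Theory.

Local Open Scope ring_scope.

(* Morphisms of a category are compared by Leibniz equality. *)
Record category := Category {
  obj :> Type;
  hom : obj -> obj -> Type;
  idm : forall x, hom x x;
  compm : forall x y z, hom y z -> hom x y -> hom x z;
  compm1 : forall x y (h : hom x y), compm h (idm x) = h;
  comp1m : forall x y (h : hom x y), compm (idm y) h = h;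
  compmA : forall x y z t (h : hom z t) (g : hom y z) (f : hom x y),
    compm h (compm g f) = compm (compm h g) f
}.

Record cat_functor (C D : category) := CatFunctor {
  fobj :> C -> D;
  fmap : forall x y : C, hom x y -> hom (fobj x) (fobj y);
  fmap_id : forall x : C, fmap (idm x) = idm (fobj x);
  fmap_comp : forall (x y z : C) (g : hom y z) (f : hom x y),
    fmap (compm g f) = compm (fmap g) (fmap f)
}.

Program Definition functor_id (C : category) : cat_functor C C :=
  @CatFunctor C C (fun x => x) (fun x y f => f) _ _.
Next Obligation. by []. Qed.
Next Obligation. by []. Qed.

Program Definition functor_comp (C D E : category)
    (G : cat_functor D E) (F : cat_functor C D) : cat_functor C E :=
  @CatFunctor C E (fun x => G (F x)) (fun x y f => fmap G (fmap F f)) _ _.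
Next Obligation. by move=> C D E G F x /=; rewrite !fmap_id. Qed.
Next Obligation. by move=> C D E G F x y z g f /=; rewrite !fmap_comp. Qed.

Record nat_iso (C D : category) (F G : cat_functor C D) := NatIso {
  nat_fwd : forall x : C, hom (F x) (G x);
  nat_bwd : forall x : C, hom (G x) (F x);
  nat_bwdK : forall x : C, compm (nat_fwd x) (nat_bwd x) = idm (G x);
  nat_fwdK : forall x : C, compm (nat_bwd x) (nat_fwd x) = idm (F x);
  nat_natural : forall (x y : C) (h : hom x y),
    compm (nat_fwd y) (fmap F h) = compm (fmap G h) (nat_fwd x)
}.

Record equivalence (C D : category) := Equivalence {
  eqv_fun : cat_functor C D;
  eqv_inv : cat_functor D C;
  eqv_unit : nat_iso (functor_id C) (functor_comp eqv_inv eqv_fun);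
  eqv_counit : nat_iso (functor_comp eqv_fun eqv_inv) (functor_id D)
}.

(* In a right action, v * (s \o t) = (v * s) * t for the composition
   (s \o t) i = s (t i) of permutations; the product of 'S_n is composition in
   the opposite order: (t * s)%g i = s (t i). *)
Definition right_perm_action (k : fieldType) (V : vectType k) (n : nat)
    (act : V -> 'S_n -> V) : Prop :=
  [/\ forall s, linear (act^~ s),
      forall v, act v 1%g = v
    & forall v s t, act v (t * s)%g = act (act v s) t].

(* Inputs are numbered from 0. If mu has arity m and nu has arity n, then in
   the composite of nu into the input i of mu, the input r of nu becomes the
   input i + r, and the input j != i of mu becomes the input outer_pos i n j. *)
Definition outer_pos (i n j : nat) : nat :=
  if (j < i)%N then j else (j + n).-1.

(* s is the permutation of the inputs of a composite that moves the inputs of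
   mu, among which the block replacing the input i, by phi, and the inputs
   inside the block by sigma; that is, the partial composite of phi and sigma
   at i in the operad of symmetric groups. By block_perm_exists and
   block_perm_unique below, there is exactly one such s. *)
Definition block_perm (m n p : nat) (i : 'I_m) (phi : 'S_m) (sigma : 'S_n)
    (s : 'S_p) : Prop :=
  (forall (r : 'I_n) (t : 'I_p),
     t = (i + r)%N :> nat -> s t = (phi i + sigma r)%N :> nat) /\
  (forall (j : 'I_m) (t : 'I_p), j != i ->
     t = outer_pos i n j :> nat -> s t = outer_pos (phi i) n (phi j) :> nat).

Lemma block_pos (m n p : nat) (e : (m + n = p.+1)%N) (i : 'I_m) (t : 'I_p) :
  (exists r : 'I_n, t = (i + r)%N :> nat) \/
  (exists2 j : 'I_m, j != i & t = outer_pos i n j :> nat).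
Proof.
have lt_t := ltn_ord t; have lt_i := ltn_ord i.
case: (ltnP t i) => [ti|it].
  right; have tm : (t < m)%N by lia.
  exists (Ordinal tm); last by rewrite /outer_pos /= ti.
  by rewrite -val_eqE /=; lia.
case: (ltnP t (i + n)) => [tin|int].
  left; have rn : (t - i < n)%N by lia.
  by exists (Ordinal rn); rewrite /=; lia.
right; have jm : ((t - n).+1 < m)%N by lia.
exists (Ordinal jm); first by rewrite -val_eqE /=; lia.
by rewrite /outer_pos /=; case: ifP; lia.
Qed.

Lemma block_perm_unique (m n p : nat) (e : (m + n = p.+1)%N) (i : 'I_m)
    (phi : 'S_m) (sigma : 'S_n) (s s' : 'S_p) :
  block_perm i phi sigma s -> block_perm i phi sigma s' -> s = s'.
Proof.
move=> [s1 s2] [s1' s2']; apply/permP => t; apply/val_inj => /=.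
case: (block_pos e i t) => [[r rt]|[j ji jt]].
  by rewrite (s1 r) // (s1' r).
by rewrite (s2 j) // (s2' j).
Qed.

Lemma block_perm_exists (m n p : nat) (e : (m + n = p.+1)%N) (i : 'I_m)
    (phi : 'S_m) (sigma : 'S_n) :
  exists s : 'S_p, block_perm i phi sigma s.
Proof.
have op_lt (a b : 'I_m) : b != a -> (outer_pos a n b < p)%N.
  rewrite -val_eqE /= /outer_pos; have := ltn_ord a; have := ltn_ord b.
  by case: ifP; lia.
have ip_lt (a : 'I_m) (r : 'I_n) : (a + r < p)%N.
  by have := ltn_ord a; have := ltn_ord r; lia.
have op_inj (a b c : 'I_m) : b != a -> c != a ->
    outer_pos a n b = outer_pos a n c -> b = c.
  rewrite -!val_eqE /= /outer_pos => ba ca H; apply: val_inj => /=.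
  by move: H; case: ifP; case: ifP; lia.
have oi_neq (a b : 'I_m) (r : 'I_n) : b != a ->
    outer_pos a n b <> (a + r)%N.
  rewrite -!val_eqE /= /outer_pos; have := ltn_ord r.
  by case: ifP; lia.
have ex (t : 'I_p) : exists u : 'I_p,
    (exists r : 'I_n, t = (i + r)%N :> nat /\ u = (phi i + sigma r)%N :> nat) \/
    (exists j : 'I_m, [/\ j != i, t = outer_pos i n j :> nat
       & u = outer_pos (phi i) n (phi j) :> nat]).
  case: (block_pos e i t) => [[r rt]|[j ji jt]].
    by exists (Ordinal (ip_lt (phi i) (sigma r))); left; exists r.
  have pji : phi j != phi i by rewrite (inj_eq perm_inj).
  by exists (Ordinal (op_lt _ _ pji)); right; exists j.
have [h hP] := choice ex.
have h_inj : injective h.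
  move=> t u /(congr1 val) /= htu; apply: val_inj => /=.
  have /= := hP t; have /= := hP u.
  case=> [[r [ur hur]]|[j [ji uj huj]]]; case=> [[r' [tr htr]]|[j' [ji' tj htj]]].
  - have rr : r' = r by apply: (@perm_inj _ sigma); apply: val_inj => /=; lia.
    by rewrite tr ur rr.
  - have /(oi_neq _ _ (sigma r)) : phi j' != phi i by rewrite (inj_eq perm_inj).
    by lia.
  - have /(oi_neq _ _ (sigma r')) : phi j != phi i by rewrite (inj_eq perm_inj).
    by lia.
  - have jj : j' = j.
      apply: (@perm_inj _ phi); apply: (op_inj (phi i));
        rewrite ?(inj_eq perm_inj) //.
      by lia.
    by rewrite tj uj jj.
exists (perm h_inj); split=> [r t rt|j t ji jt]; rewrite permE.
  have [[r' [tr' ->]]|[j [ji tj _]]] := hP t; last first.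
    by case: (oi_neq i j r ji); lia.
  by have -> : r' = r by apply: val_inj => /=; lia.
have [[r [tr _]]|[j' [ji' tj ->]]] := hP t.
  by case: (oi_neq i j r ji); lia.
by have -> : j' = j by apply: (op_inj i) => //; lia.
Qed.

(* Symmetric operads with finite dimensional components. The composite of
   elements of arities m >= 1 and n has arity p = m + n - 1; taking p together
   with a proof of m + n = p.+1 avoids casts between components. The input
   numbers k + m - 1 and i + j of the associativity axioms are named by
   ordinals with the prescribed values. *)
Record operad (k : fieldType) := Operad {
  op_sort :> nat -> vectType k;
  op_act : forall n, op_sort n -> 'S_n -> op_sort n;
  op_one : op_sort 1%N;
  op_comp : forall m n p, (m + n = p.+1)%N -> 'I_m ->
    op_sort m -> op_sort n -> op_sort p;
  op_actP : forall n, right_perm_action (@op_act n);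
  op_comp_linl : forall m n p (e : (m + n = p.+1)%N) i nu,
    linear (fun mu => op_comp e i mu nu);
  op_comp_linr : forall m n p (e : (m + n = p.+1)%N) i mu,
    linear (fun nu => op_comp e i mu nu);
  op_comp_one : forall n (e : (n + 1 = n.+1)%N) (i : 'I_n) (mu : op_sort n),
    op_comp e i mu op_one = mu;
  op_one_comp : forall n (e : (1 + n = n.+1)%N) (i : 'I_1) (mu : op_sort n),
    op_comp e i op_one mu = mu;
  op_comp_seq : forall l m n lm mn lmn
      (e1 : (l + m = lm.+1)%N) (e2 : (lm + n = lmn.+1)%N)
      (e3 : (m + n = mn.+1)%N) (e4 : (l + mn = lmn.+1)%N)
      (i : 'I_l) (j : 'I_m) (ij : 'I_lm)
      (la : op_sort l) (mu : op_sort m) (nu : op_sort n),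
    ij = (i + j)%N :> nat ->
    op_comp e2 ij (op_comp e1 i la mu) nu =
    op_comp e4 i la (op_comp e3 j mu nu);
  op_comp_par : forall l m n lm ln lmn
      (e1 : (l + m = lm.+1)%N) (e2 : (lm + n = lmn.+1)%N)
      (e3 : (l + n = ln.+1)%N) (e4 : (ln + m = lmn.+1)%N)
      (i j : 'I_l) (j' : 'I_lm) (i' : 'I_ln)
      (la : op_sort l) (mu : op_sort m) (nu : op_sort n),
    (i < j)%N -> j'.+1 = (j + m)%N :> nat -> i' = i :> nat ->
    op_comp e2 j' (op_comp e1 i la mu) nu =
    op_comp e4 i' (op_comp e3 j la nu) mu;
  op_comp_act : forall m n p (e : (m + n = p.+1)%N) (i : 'I_m)
      (phi : 'S_m) (sigma : 'S_n) (s : 'S_p)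
      (mu : op_sort m) (nu : op_sort n),
    block_perm i phi sigma s ->
    op_comp e i (op_act mu phi) (op_act nu sigma) =
    op_act (op_comp e (phi i) mu nu) s
}.

Record operad_hom (k : fieldType) (P Q : operad k) := OperadHom {
  oh_fun :> forall n, 'Hom(P n, Q n);
  oh_act : forall n (mu : P n) (s : 'S_n),
    oh_fun n (op_act mu s) = op_act (oh_fun n mu) s;
  oh_one : oh_fun 1%N (op_one P) = op_one Q;
  oh_comp : forall m n p (e : (m + n = p.+1)%N) (i : 'I_m) (mu : P m) (nu : P n),
    oh_fun p (op_comp e i mu nu) = op_comp e i (oh_fun m mu) (oh_fun n nu)
}.

Record unitary_operad (k : fieldType) := UnitaryOperad {
  uo_operad :> operad k;
  uo_unit : uo_operad 0%N;
  uo_unitP : basis_of {: uo_operad 0%N} [:: uo_unit]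
}.

Section OperadHoms.
Variable k : fieldType.

Lemma operad_hom_ext (P Q : operad k) (f g : operad_hom P Q) :
  (forall n (mu : P n), f n mu = g n mu) -> f = g.
Proof.
case: f => f f1 f2 f3; case: g => g g1 g2 g3 /= fg.
have E : f = g.
  by apply: functional_extensionality_dep => n; apply/lfunP => x; apply: fg.
subst g; rewrite (Prop_irrelevance f1 g1) (Prop_irrelevance f2 g2).
by rewrite (Prop_irrelevance f3 g3).
Qed.

Program Definition operad_hom_id (P : operad k) : operad_hom P P :=
  @OperadHom k P P (fun n => \1%VF) _ _ _.
Next Obligation. by move=> P n mu s; rewrite !id_lfunE. Qed.
Next Obligation. by move=> P; rewrite !id_lfunE. Qed.
Next Obligation. by move=> P m n p e i mu nu; rewrite !id_lfunE. Qed.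

Program Definition operad_hom_comp (P Q S : operad k)
    (g : operad_hom Q S) (f : operad_hom P Q) : operad_hom P S :=
  @OperadHom k P S (fun n => (g n \o f n)%VF) _ _ _.
Next Obligation. by move=> P Q S g f n mu s; rewrite !comp_lfunE !oh_act. Qed.
Next Obligation. by move=> P Q S g f; rewrite !comp_lfunE !oh_one. Qed.
Next Obligation.
by move=> P Q S g f m n p e i mu nu; rewrite !comp_lfunE !oh_comp.
Qed.

End OperadHoms.

Program Definition Com_operad (k : fieldType) : operad k :=
  @Operad k (fun _ => k^o : vectType k) (fun n v _ => v) 1
    (fun m n p _ _ a b => a * b) _ _ _ _ _ _ _ _.
Next Obligation. by []. Qed.
Next Obligation. by move=> k m n p e i b c x y /=; rewrite mulrDl scalerAl. Qed.
Next Obligation. by move=> k m n p e i b c x y /=; rewrite mulrDr scalerAr. Qed.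
Next Obligation. by move=> k n e i mu /=; rewrite mulr1. Qed.
Next Obligation. by move=> k n e i mu /=; rewrite mul1r. Qed.
Next Obligation. by move=> * /=; rewrite mulrA. Qed.
Next Obligation. by move=> * /=; rewrite mulrAC. Qed.
Next Obligation. by []. Qed.

Program Definition Com (k : fieldType) : unitary_operad k :=
  @UnitaryOperad k (Com_operad k) (1 : k^o) _.
Next Obligation.
move=> k; rewrite basisEfree seq1_free oner_neq0 /= subvf /=.
by rewrite dimvf.
Qed.

Record comaug_operad (k : fieldType) := ComaugOperad {
  ca_operad :> unitary_operad k;
  ca_aug : operad_hom (Com k) ca_operad;
  ca_aug_unit : ca_aug 0%N (uo_unit (Com k)) = uo_unit ca_operad
}.

Record comaug_hom (k : fieldType) (P Q : comaug_operad k) := ComaugHom {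
  ch_hom :> operad_hom P Q;
  ch_aug : operad_hom_comp ch_hom (ca_aug P) = ca_aug Q
}.

Section GKdim.
Local Open Scope ereal_scope.

(* log_n x = ln x / ln n; the terms n = 0, 1 do not affect the limit superior. *)
Definition GKdim (R : realType) (k : fieldType) (P : operad k) : \bar R :=
  limn_esup (fun n : nat =>
    (ln (\sum_(i < n.+1) \dim {: P i})%N%:R / ln n%:R)%R%:E).

End GKdim.

Record comaug_operad3 (R : realType) (k : fieldType) := ComaugOperad3 {
  c3_operad :> comaug_operad k;
  c3_GKdim : GKdim R c3_operad = 3%:E
}.

Section ComaugCategory.
Variable k : fieldType.

Lemma comaug_hom_ext (P Q : comaug_operad k) (f g : comaug_hom P Q) :
  (forall n (mu : P n), f n mu = g n mu) -> f = g.
Proof.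
case: f => f f1; case: g => g g1 /= fg.
have E : f = g by apply: operad_hom_ext.
by subst g; rewrite (Prop_irrelevance f1 g1).
Qed.

Program Definition comaug_hom_id (P : comaug_operad k) : comaug_hom P P :=
  @ComaugHom k P P (operad_hom_id P) _.
Next Obligation.
by move=> P; apply: operad_hom_ext => n mu /=; rewrite comp_lfunE id_lfunE.
Qed.

Program Definition comaug_hom_comp (P Q S : comaug_operad k)
    (g : comaug_hom Q S) (f : comaug_hom P Q) : comaug_hom P S :=
  @ComaugHom k P S (operad_hom_comp g f) _.
Next Obligation.
move=> P Q S g f; rewrite -(ch_aug g) -(ch_aug f).
by apply: operad_hom_ext => n mu /=; rewrite !comp_lfunE.
Qed.

End ComaugCategory.

Program Definition comaug_operad3_cat (R : realType) (k : fieldType) : category :=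
  @Category (comaug_operad3 R k) (fun P Q => comaug_hom P Q)
    (fun P => comaug_hom_id P) (fun P Q S g f => comaug_hom_comp g f) _ _ _.
Next Obligation.
by move=> R k P Q f; apply: comaug_hom_ext => n mu; rewrite comp_lfunE id_lfunE.
Qed.
Next Obligation.
by move=> R k P Q f; apply: comaug_hom_ext => n mu; rewrite comp_lfunE id_lfunE.
Qed.
Next Obligation.
by move=> R k P Q S T h g f; apply: comaug_hom_ext => n mu; rewrite !comp_lfunE.
Qed.

Section AugmentationIdeal.
Variables (k : fieldType) (A : falgType k) (eps : 'AHom(A, k^o)).

Definition aug_ideal : {vspace A} := lker eps.

Lemma aug_idealMr (x : subvs_of aug_ideal) (c : A) : vsval x * c \in aug_ideal.
Proof.
by rewrite memv_ker rmorphM /=; have := subvsP x; rewrite memv_ker => /eqP->;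
  rewrite mul0r.
Qed.

Definition aug_mulr (x : subvs_of aug_ideal) (c : A) : subvs_of aug_ideal :=
  Subvs (aug_idealMr x c).

End AugmentationIdeal.

(* A right module structure over A (x) A is given by the operation
   (mu, a, b) |-> mu . (a (x) b), linear in each argument; likewise, g is given
   by a bilinear map. *)
Record trident (k : fieldType) := Trident {
  td_alg : falgType k;
  td_eps : 'AHom(td_alg, k^o);
  td_mod : vectType k;
  td_lact : td_alg -> td_mod -> td_mod;
  td_ract : td_mod -> td_alg -> td_alg -> td_mod;
  td_act : td_mod -> 'S_2 -> td_mod;
  td_f : subvs_of (aug_ideal td_eps) -> td_mod;
  td_g : subvs_of (aug_ideal td_eps) -> subvs_of (aug_ideal td_eps) -> td_mod;
  td_mod_neq0 : {: td_mod}%VS != 0%VS;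
  td_lact_linl : forall mu, linear (fun a => td_lact a mu);
  td_lact_linr : forall a, linear (td_lact a);
  td_lact1 : forall mu, td_lact 1 mu = mu;
  td_lactM : forall a b mu, td_lact (a * b) mu = td_lact a (td_lact b mu);
  td_ract_lin : forall a b, linear (fun mu => td_ract mu a b);
  td_ract_linl : forall mu b, linear (fun a => td_ract mu a b);
  td_ract_linr : forall mu a, linear (td_ract mu a);
  td_ract1 : forall mu, td_ract mu 1 1 = mu;
  td_ractM : forall mu a b c d,
    td_ract mu (a * c) (b * d) = td_ract (td_ract mu a b) c d;
  td_lract : forall a mu b c,
    td_lact a (td_ract mu b c) = td_ract (td_lact a mu) b c;
  td_actP : right_perm_action td_act;
  td_lact_act : forall a mu,
    td_lact a (td_act mu (tperm ord0 ord_max)) =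
    td_act (td_lact a mu) (tperm ord0 ord_max);
  td_ract_act : forall mu a b,
    td_act (td_ract mu a b) (tperm ord0 ord_max) =
    td_ract (td_act mu (tperm ord0 ord_max)) b a;
  td_f_lin : linear td_f;
  td_f_act : forall a, td_act (td_f a) (tperm ord0 ord_max) = td_f a;
  td_g_linl : forall b, linear (fun a => td_g a b);
  td_g_linr : forall a, linear (td_g a);
  td_g_ract : forall a b c d,
    td_g (aug_mulr a c) (aug_mulr b d) = td_ract (td_g a b) c d;
  td_g_act : forall a b, td_act (td_g a b) (tperm ord0 ord_max) = td_g b a;
  td_fM : forall a b,
    td_f (aug_mulr a (vsval b)) =
    td_lact (vsval a) (td_f b) + td_ract (td_f a) (vsval b) 1
      + td_ract (td_f a) 1 (vsval b) + td_g a b + td_g b a;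
  td_f_ract : forall a b c,
    td_ract (td_f a) (vsval b) (vsval c) =
    td_lact (vsval a) (td_g b c) - td_g (aug_mulr a (vsval b)) c
      - td_g b (aug_mulr a (vsval c))
}.

Definition td_ideal (k : fieldType) (T : trident k) : {vspace td_alg T} :=
  aug_ideal (td_eps T).

(* When alpha commutes with the augmentations, it maps td_ideal S into
   td_ideal T, and vsproj only changes the type of alpha (vsval x). *)
Definition aug_restr (k : fieldType) (S T : trident k)
    (alpha : 'AHom(td_alg S, td_alg T)) (x : subvs_of (td_ideal S)) :
    subvs_of (td_ideal T) :=
  vsproj (td_ideal T) (alpha (vsval x)).

Record trident_hom (k : fieldType) (S T : trident k) := TridentHom {
  th_alg : 'AHom(td_alg S, td_alg T);
  th_mod : 'Hom(td_mod S, td_mod T);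
  th_eps : forall a, td_eps T (th_alg a) = td_eps S a;
  th_act : forall mu s, th_mod (td_act mu s) = td_act (th_mod mu) s;
  th_lact : forall a mu, th_mod (td_lact a mu) = td_lact (th_alg a) (th_mod mu);
  th_ract : forall mu a b,
    th_mod (td_ract mu a b) = td_ract (th_mod mu) (th_alg a) (th_alg b);
  th_f : forall a : subvs_of (td_ideal S),
    th_mod (td_f a) = td_f (aug_restr th_alg a);
  th_g : forall a b : subvs_of (td_ideal S),
    th_mod (td_g a b) = td_g (aug_restr th_alg a) (aug_restr th_alg b)
}.

Section TridentCategory.
Variable k : fieldType.
Implicit Types S T U : trident k.

Lemma aug_restrE S T (alpha : 'AHom(td_alg S, td_alg T))
    (x : subvs_of (td_ideal S)) :
  (forall a, td_eps T (alpha a) = td_eps S a) ->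
  vsval (aug_restr alpha x) = alpha (vsval x).
Proof.
move=> ae; rewrite vsprojK // memv_ker ae -memv_ker.
exact: subvsP.
Qed.

Lemma trident_hom_ext S T (h h' : trident_hom S T) :
  th_alg h =1 th_alg h' -> th_mod h =1 th_mod h' -> h = h'.
Proof.
case: h => a b h1 h2 h3 h4 h5 h6; case: h' => a' b' h1' h2' h3' h4' h5' h6' /=.
move=> aa bb; have Ea : a = a' by apply/val_inj/lfunP.
have Eb : b = b' by apply/lfunP.
subst a' b'; rewrite (Prop_irrelevance h1 h1') (Prop_irrelevance h2 h2').
rewrite (Prop_irrelevance h3 h3') (Prop_irrelevance h4 h4').
by rewrite (Prop_irrelevance h5 h5') (Prop_irrelevance h6 h6').
Qed.

Lemma aug_restr_id T (x : subvs_of (td_ideal T)) :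
  aug_restr (id_ahom (td_alg T)) x = x.
Proof.
by apply: val_inj; rewrite [LHS]aug_restrE /= => [|a]; rewrite !id_lfunE.
Qed.

Program Definition trident_hom_id T : trident_hom T T :=
  @TridentHom k T T (id_ahom (td_alg T)) \1%VF _ _ _ _ _ _.
Next Obligation. by move=> T a; rewrite id_lfunE. Qed.
Next Obligation. by move=> T mu s; rewrite !id_lfunE. Qed.
Next Obligation. by move=> T a mu; rewrite !id_lfunE. Qed.
Next Obligation. by move=> T mu a b; rewrite !id_lfunE. Qed.
Next Obligation. by move=> T a; rewrite id_lfunE aug_restr_id. Qed.
Next Obligation. by move=> T a b; rewrite id_lfunE !aug_restr_id. Qed.

Lemma aug_restr_comp S T U (h : trident_hom T U) (g : trident_hom S T)
    (x : subvs_of (td_ideal S)) :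
  aug_restr (comp_ahom (th_alg h) (th_alg g)) x =
  aug_restr (th_alg h) (aug_restr (th_alg g) x).
Proof.
apply: val_inj; rewrite [RHS]aug_restrE; last exact: th_eps.
rewrite aug_restrE; last exact: th_eps.
rewrite [LHS]aug_restrE /= => [|a]; rewrite !comp_lfunE //.
by rewrite !th_eps.
Qed.

Program Definition trident_hom_comp S T U
    (h : trident_hom T U) (g : trident_hom S T) : trident_hom S U :=
  @TridentHom k S U (comp_ahom (th_alg h) (th_alg g))
    (th_mod h \o th_mod g)%VF _ _ _ _ _ _.
Next Obligation. by move=> S T U h g a; rewrite comp_lfunE !th_eps. Qed.
Next Obligation. by move=> S T U h g mu s; rewrite !comp_lfunE !th_act. Qed.
Next Obligation. by move=> S T U h g a mu; rewrite !comp_lfunE !th_lact. Qed.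
Next Obligation. by move=> S T U h g mu a b; rewrite !comp_lfunE !th_ract. Qed.
Next Obligation. by move=> S T U h g a; rewrite comp_lfunE !th_f aug_restr_comp. Qed.
Next Obligation.
by move=> S T U h g a b; rewrite comp_lfunE !th_g !aug_restr_comp.
Qed.

Program Definition trident_cat : category :=
  @Category (trident k) (@trident_hom k) trident_hom_id trident_hom_comp _ _ _.
Next Obligation.
by move=> S T h; apply: trident_hom_ext => a; rewrite comp_lfunE id_lfunE.
Qed.
Next Obligation.
by move=> S T h; apply: trident_hom_ext => a; rewrite comp_lfunE id_lfunE.
Qed.
Next Obligation.
by move=> S T U V h g f; apply: trident_hom_ext => a; rewrite !comp_lfunE.
Qed.

End TridentCategory.

(* Main.v *)
(* A Com-augmented operad P has faces x |-> x o_i 1_0 and degeneracies built from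
   1_2, which satisfy the simplicial identities. Let V_n be the space of the
   elements of P(n) that all faces annihilate. The degeneracies split the faces,
   so that dim P(n) is the sum of the C(n, j) dim V_j, and the dimension of P is 3
   if and only if V_2 <> 0 and V_n = 0 for all n >= 3. In that case an element of
   arity at least 3 is determined by its faces, which Moore's filler allows to
   prescribe arbitrarily up to the simplicial identities: a morphism into P is the
   same as a map in arities at most 2 that respects the compositions there. This
   makes the functor sending P to A = P(1), M = V_2, f a = a o 1_2 - 1_2 (a, 1)
   - 1_2 (1, a), g (a, b) = 1_2 (a, b) fully faithful. Conversely a trident algebra
   determines a bimodule P(2), and an operation of arity n is described by its
   restrictions to one and two inputs; the operad axioms then amount to the axioms
   of a bimodule. *)
From HB Require Import structures.
From mathcomp Require Import all_boot all_order all_fingroup all_algebra all_field.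
From mathcomp Require Import zify ring.
From mathcomp Require Import all_classical all_reals all_analysis.
Require Import Defs.

Set Implicit Arguments.
Unset Strict Implicit.
Unset Printing Implicit Defensive.

Import Order.TTheory GRing.Theory Num.Theory.

Local Open Scope ring_scope.

(** * Equivalences of categories *)

(** No functor from trident algebras to operads is written out: the functor from operads is shown to
    be fully faithful and essentially surjective, and choice supplies the rest. The obstacle is
    essential surjectivity, because a trident algebra knows only arities at most 2 whereas the
    operad axioms involve all arities. The way out is that a pair of inputs of a composite sees
    little of each factor: a factor that it meets in a single input contributes an element of A, and
    a substituted factor that it does not meet contributes a scalar. Tested on a pair of inputs,
    every axiom thus becomes one identity between actions on P(2), selected by the factors from
    which the two inputs come. No characteristic is excluded: values in M are stored for increasing
    pairs of inputs and recovered for the others by the transposition, so nothing is symmetrized.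
    The number 3 arises as 2, the degree of growth of dim P(n), plus 1 for the summation over
    arities. *)

Lemma equivalence_of_ff_es (C D : category) (G : cat_functor D C) :
    (forall x y (g g' : hom x y), fmap G g = fmap G g' -> g = g') ->
    (forall x y (h : hom (G x) (G y)), exists g : hom x y, fmap G g = h) ->
    (forall c : C, exists (d : D) (f : hom c (G d)) (g : hom (G d) c),
       compm f g = idm (G d) /\ compm g f = idm c) ->
  inhabited (equivalence C D).
Proof.
move=> faithful full es.
pose iso_over (c : C) := {d : D & {f : hom c (G d) & {g : hom (G d) c |
  compm f g = idm (G d) /\ compm g f = idm c}}}.
(* [ob], [fw] and [bw] are all read off this single choice, so they fit together. *)
have iso_of (c : C) : iso_over c.
  case/cid: (es c) => d /cid[f] /cid[g fg].
  by exists d, f, g.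
pose ob c := projT1 (iso_of c).
pose fw c : hom c (G (ob c)) := projT1 (projT2 (iso_of c)).
pose bw c : hom (G (ob c)) c := sval (projT2 (projT2 (iso_of c))).
have fwbw c : compm (fw c) (bw c) = idm _.
  by case: (svalP (projT2 (projT2 (iso_of c)))).
have bwfw c : compm (bw c) (fw c) = idm _.
  by case: (svalP (projT2 (projT2 (iso_of c)))).
pose lift x y (h : hom (G x) (G y)) : hom x y := sval (cid (full x y h)).
have liftE x y h : fmap G (@lift x y h) = h := svalP (cid (full x y h)).
pose F_fmap x y (h : hom x y) := lift _ _ (compm (fw y) (compm h (bw x))).
have F_id x : F_fmap x x (idm x) = idm (ob x).
  by apply: faithful; rewrite liftE comp1m fwbw fmap_id.
have F_comp x y z (g : hom y z) (f : hom x y) :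
    F_fmap x z (compm g f) = compm (F_fmap y z g) (F_fmap x y f).
  apply: faithful; rewrite fmap_comp !liftE -!compmA.
  by rewrite (compmA (bw y) (fw y)) bwfw comp1m.
pose F := @CatFunctor C D ob F_fmap F_id F_comp.
constructor; refine (@Equivalence C D F G _ _).
- refine (@NatIso C C (functor_id C) (functor_comp G F) fw bw fwbw bwfw _).
  by move=> x y h; rewrite /= liftE -!compmA bwfw compm1.
- refine (@NatIso D D (functor_comp F G) (functor_id D)
    (fun d => lift _ _ (bw (G d))) (fun d => lift _ _ (fw (G d))) _ _ _) => [d|d|x y h].
  + by apply: faithful; rewrite fmap_comp !liftE bwfw fmap_id.
  + by apply: faithful; rewrite fmap_comp !liftE fwbw fmap_id.
  + by apply: faithful; rewrite /= !fmap_comp !liftE compmA bwfw comp1m.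
Qed.

(** * Faces, degeneracies and fillers *)

Section OperadLinearity.
Variables (k : fieldType) (P : operad k).

(** The linear argument comes last, so that a linear structure can be attached to the partial
    application; [op_compl] below is of the same kind. *)
Definition op_actr n s (v : P n) : P n := op_act v s.

Lemma op_act_linear n s : linear (@op_actr n s).
Proof. by case: (@op_actP k P n) => /(_ s). Qed.
HB.instance Definition _ n s :=
  GRing.isLinear.Build k (P n) (P n) *:%R (@op_actr n s) (@op_act_linear n s).

Section Act.
Variables (n : nat) (s : 'S_n).
Implicit Types v : P n.

Lemma op_actD v w : op_act (v + w) s = op_act v s + op_act w s.
Proof. exact: (linearD (op_actr s)). Qed.

Lemma op_actZ c v : op_act (c *: v) s = c *: op_act v s.
Proof. exact: (linearZ_LR (op_actr s)). Qed.

Lemma op_act0 : op_act (0 : P n) s = 0.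
Proof. exact: (linear0 (op_actr s)). Qed.

End Act.

Lemma op_act1 n (v : P n) : op_act v 1%g = v.
Proof. by case: (@op_actP k P n). Qed.

Lemma op_actM n (v : P n) s t : op_act v (t * s)%g = op_act (op_act v s) t.
Proof. by case: (@op_actP k P n). Qed.

Definition op_compl m n p (e : (m + n = p.+1)%N) i (nu : P n) (mu : P m) : P p :=
  op_comp e i mu nu.
HB.instance Definition _ m n p (e : (m + n = p.+1)%N) i nu :=
  GRing.isLinear.Build k (P m) (P p) *:%R (op_compl e i nu)
    (@op_comp_linl k P m n p e i nu).
HB.instance Definition _ m n p (e : (m + n = p.+1)%N) i mu :=
  GRing.isLinear.Build k (P n) (P p) *:%R (@op_comp k P m n p e i mu)
    (@op_comp_linr k P m n p e i mu).

Section Left.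
Variables (m n p : nat) (e : (m + n = p.+1)%N) (i : 'I_m) (nu : P n).
Implicit Types mu : P m.

Lemma op_compDl mu mu' :
  op_comp e i (mu + mu') nu = op_comp e i mu nu + op_comp e i mu' nu.
Proof. exact: (linearD (op_compl e i nu)). Qed.

Lemma op_compZl c mu : op_comp e i (c *: mu) nu = c *: op_comp e i mu nu.
Proof. exact: (linearZ_LR (op_compl e i nu)). Qed.

End Left.

Section Right.
Variables (m n p : nat) (e : (m + n = p.+1)%N) (i : 'I_m) (mu : P m).
Implicit Types nu : P n.

Lemma op_compDr nu nu' :
  op_comp e i mu (nu + nu') = op_comp e i mu nu + op_comp e i mu nu'.
Proof. exact: linearD. Qed.

Lemma op_compZr c nu : op_comp e i mu (c *: nu) = c *: op_comp e i mu nu.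
Proof. exact: linearZ_LR. Qed.

End Right.

Lemma op_comp_irr m n p (e e' : (m + n = p.+1)%N) (i i' : 'I_m)
    (mu : P m) (nu : P n) :
  i = i' :> nat -> op_comp e i mu nu = op_comp e' i' mu nu.
Proof. by move=> /val_inj ->; rewrite (eq_irrelevance e e'). Qed.

End OperadLinearity.

Section Faces.
Variables (k : fieldType) (P : comaug_operad k).

Definition com_elt n : P n := ca_aug P n (1 : k^o).

Lemma com_elt0 : com_elt 0 = uo_unit P.
Proof. exact: ca_aug_unit. Qed.

Lemma com_elt1 : com_elt 1 = op_one P.
Proof. exact: (oh_one (ca_aug P)). Qed.

Lemma com_elt_act n s : op_act (com_elt n) s = com_elt n.
Proof. by rewrite -oh_act. Qed.

Lemma com_elt_comp m n p (e : (m + n = p.+1)%N) i :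
  op_comp e i (com_elt m) (com_elt n) = com_elt p.
Proof. by rewrite -oh_comp /= mulr1. Qed.

Lemma op_comp1 n (e : (n + 1 = n.+1)%N) i (mu : P n) :
  op_comp e i mu (com_elt 1) = mu.
Proof. by rewrite com_elt1 op_comp_one. Qed.

Lemma op_1comp n (e : (1 + n = n.+1)%N) i (mu : P n) :
  op_comp e i (com_elt 1) mu = mu.
Proof. by rewrite com_elt1 op_one_comp. Qed.

Lemma arity0_gen (x : P 0%N) : exists c, x = c *: com_elt 0.
Proof.
have [_ /vlineP[c ->]] : True /\ x \in <[uo_unit P]>%VS.
  by rewrite -span_seq1 (span_basis (uo_unitP P)) memvf.
by exists c; rewrite com_elt0.
Qed.

Lemma com_elt0_neq0 : com_elt 0 != 0.
Proof.
by rewrite com_elt0; have := basis_free (uo_unitP P); rewrite seq1_free.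
Qed.

(** The index is a natural number, so that simplicial arithmetic such as [j.-1] stays in [nat]. Out
    of range [inord] returns the input 0, hence the bounds in the simplicial identities. *)
Definition face n i (x : P n.+1) : P n :=
  op_comp (addn0 n.+1) (inord i) x (com_elt 0).

Lemma faceE n (e : (n.+1 + 0 = n.+1)%N) i x :
  op_comp e i x (com_elt 0) = face (n := n) i x.
Proof. by apply: op_comp_irr; rewrite inord_val. Qed.

Lemma face_linear n i : linear (@face n i).
Proof. by move=> c x y; rewrite /face op_comp_linl. Qed.
HB.instance Definition _ n i :=
  GRing.isLinear.Build k (P n.+1) (P n) *:%R (@face n i) (@face_linear n i).

Lemma face_com n i : face i (com_elt n.+1) = com_elt n.
Proof. exact: com_elt_comp. Qed.

Lemma face_face n i j (x : P n.+2) : (i < j <= n.+1)%N ->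
  face i (face j x) = face j.-1 (face i x).
Proof.
move=> /andP[ij jn]; apply/esym; apply: op_comp_par.
- by rewrite !inordK //; lia.
- by rewrite !inordK; lia.
- by rewrite !inordK; lia.
Qed.

(* For j < n the input j is split in two, and for j = n an input that the
   composite ignores is added at the end. In both cases the new input n can be
   removed by a face, and so all faces of an element can be prescribed. *)
Definition degen n j (x : P n) : P n.+1 :=
  if insub j is Some i then op_comp (addn2 n) i x (com_elt 2)
  else op_comp (erefl n.+2 : (2 + n = n.+2)%N) ord0 (com_elt 2) x.

Lemma degen_linear n j : linear (@degen n j).
Proof.
move=> c x y; rewrite /degen; case: insubP => [i _ _|_].
  exact: op_comp_linl.
exact: op_comp_linr.
Qed.
HB.instance Definition _ n j :=
  GRing.isLinear.Build k (P n) (P n.+1) *:%R (@degen n j) (@degen_linear n j).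

(** This lets the filler correct the faces in increasing order: adding [degen j] of an element whose
    face [i] vanishes keeps the face [i]. A split input commutes with the removal of an earlier one
    by the parallel axiom, the added last input by the sequential one. *)
Lemma face_degen n i j (x : P n.+1) : (i < j <= n.+1)%N ->
  face i (degen j x) = degen j.-1 (face i x).
Proof.
move=> /andP[ij jn]; rewrite /degen.
case: insubP => [j' jlt j'E|]; last first.
  rewrite -leqNgt => nj; case: insubP => [? ? ?|_]; first lia.
  by apply: op_comp_seq; rewrite !inordK //; lia.
case: insubP => [j2 j2lt j2E|]; last lia.
apply/esym; apply: op_comp_par; last by rewrite !inordK //; lia.
  by rewrite inordK //=; move: j'E => /=; lia.
by move: j'E j2E => /=; lia.
Qed.

Lemma face_degen_id n j (x : P n) : (j <= n)%N -> face j (degen j x) = x.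
Proof.
move=> jn; rewrite /degen; case: insubP => [i ilt iE|].
  rewrite /face (@op_comp_seq k P _ _ _ _ _ _ _ _ (addn0 2) (addn1 n)
    i ord0) //; last first.
    by rewrite inordK // addn0 -iE.
  by rewrite com_elt_comp op_comp1.
rewrite -leqNgt => nj; have {nj jn} -> : j = n by apply/eqP; rewrite eqn_leq jn.
rewrite /face (@op_comp_par k P _ _ _ _ _ _ _ _ (addn0 2) (add1n n) ord0 ord_max
  _ ord0) //=; last by rewrite inordK.
by rewrite com_elt_comp op_1comp.
Qed.

End Faces.

(** Joint injectivity of the faces in arities above [d]. Fillers exist in every [comaug_operad], so
    uniqueness is all that has to be required. *)
Definition coskeletal d (k : fieldType) (P : comaug_operad k) :=
  forall n (x : P n.+1), (d <= n)%N ->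
    (forall i, (i <= n)%N -> face i x = 0) -> x = 0.

Section Filler.
Variables (k : fieldType) (P : comaug_operad k).

(* Moore's filler for simplicial groups: corrects the faces one after another. *)
Fixpoint filler n (y : nat -> P n) j : P n.+1 :=
  let x := if j is j'.+1 then filler y j' else 0 in
  x + degen j (y j - face j x).

Arguments filler : simpl never.

Lemma filler_linear n c (y y' : nat -> P n) j :
  filler (fun i => c *: y i + y' i) j = c *: filler y j + filler y' j.
Proof.
elim: j => [|j IH]; rewrite /filler -/filler.
  by rewrite !linear0 ?subr0 ?addr0 !add0r linearP.
rewrite IH !(linearB, linearP) /=.
set a := filler y j; set b := filler y' j.
set a1 := degen _ (y _); set b1 := degen _ (y' _).
set a2 := degen _ (face _ a); set b2 := degen _ (face _ b).
by rewrite !scalerDr (addrACA (c *: a1)) (addrACA (c *: a)).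
Qed.

Lemma face_filler n (y : nat -> P n.+1) j i :
  (forall i j, (i < j <= n.+1)%N -> face i (y j) = face j.-1 (y i)) ->
  (i <= j <= n.+1)%N -> face i (filler y j) = y i.
Proof.
move=> yC; elim: j => [|j IH] ijn; rewrite /filler -/filler linearD /=.
  have -> : i = 0%N by lia.
  by rewrite linear0 face_degen_id // subr0 add0r.
have [->|ij] := eqVneq i j.+1.
  by rewrite face_degen_id ?subrKC //; lia.
(* The face [i] of the last correction is a degeneracy of [face i (y j.+1) - face i (face j.+1 x)],
   and both terms equal [face j (y i)], by compatibility of [y] and by induction. *)
rewrite IH; last lia.
rewrite face_degen; last lia.
rewrite linearB /= yC; last lia.
rewrite face_face; last lia.
by rewrite IH ?subrr ?linear0 ?addr0 //; lia.
Qed.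

End Filler.

(** * Morphisms into 2-coskeletal operads *)

Lemma face_comp_in (k : fieldType) (P : comaug_operad k) m n p
    (e : (m + n.+1 = p.+2)%N) (e' : (m + n = p.+1)%N) (i : 'I_m) r
    (x : P m) (y : P n.+1) : (r <= n)%N ->
  face (i + r) (op_comp e i x y) = op_comp e' i x (face r y).
Proof.
move=> rn; have lt_i := ltn_ord i.
by apply: op_comp_seq; rewrite !inordK //; lia.
Qed.

(** By the parallel axiom the removal of another input of [x] can be done first; [i] moves down by
    one if the removed input precedes it. *)
Lemma face_comp_out (k : fieldType) (P : comaug_operad k) m n p
    (e : (m.+1 + n = p.+2)%N) (e' : (m + n = p.+1)%N) (i j : 'I_m.+1)
    (i' : 'I_m) (x : P m.+1) (y : P n) :
  j != i -> i' = (if (j < i)%N then i.-1 else i) :> nat ->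
  face (outer_pos i n j) (op_comp e i x y) = op_comp e' i' (face j x) y.
Proof.
rewrite -val_eqE /= /outer_pos => ji; have lt_i := ltn_ord i.
have lt_j := ltn_ord j; rewrite /face inord_val.
case: ifP => ij i'E; last first.
  by apply: op_comp_par; rewrite ?inordK //; lia.
by apply/esym; apply: op_comp_par; rewrite ?inordK //; lia.
Qed.

(** [s'] is the permutation induced on the remaining inputs. It is chosen before the operad, so that
    the same [s'] serves in the source and in the target of a map. *)
Lemma face_act n (s : 'S_n.+1) (t : 'I_n.+1) : exists s' : 'S_n,
  forall (k : fieldType) (P : comaug_operad k) (x : P n.+1),
    face t (op_act x s) = op_act (face (s t) x) s'.
Proof.
have [s' s'P] := block_perm_exists (addn0 n.+1) t s 1.
exists s' => k P x; rewrite /face !inord_val -{1}(com_elt_act P 1).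
exact: op_comp_act.
Qed.

Lemma perm2_cases (s : 'S_2) : s = 1%g \/ s = tperm ord0 ord_max.
Proof.
have ordP (i : 'I_2) : i = ord0 \/ i = ord_max.
  by case: i => [[|[|?]] ?] //; [left|right]; apply: val_inj.
have [s0|s0] := ordP (s ord0); [left|right]; apply/permP => i.
  rewrite perm1; have [->//|->] := ordP i.
  have [s1|//] := ordP (s ord_max).
  by have /perm_inj : s ord_max = s ord0 by rewrite s1.
have [->|->] := ordP i; rewrite ?tpermL ?tpermR //.
have [//|s1] := ordP (s ord_max).
by have /perm_inj : s ord_max = s ord0 by rewrite s1.
Qed.

Section Extension.
Variables (k : fieldType) (P Q : comaug_operad k).

Lemma comaug_hom_com (h : comaug_hom P Q) n : h n (com_elt P n) = com_elt Q n.
Proof.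
by rewrite /com_elt -(ch_aug h) comp_lfunE.
Qed.

Lemma comaug_hom_face (h : comaug_hom P Q) n i (x : P n.+1) :
  h n (face i x) = face i (h n.+1 x).
Proof. by rewrite /face oh_comp comaug_hom_com. Qed.

Lemma comaug_hom_0 (h h' : comaug_hom P Q) (x : P 0%N) : h 0%N x = h' 0%N x.
Proof.
by have [c ->] := arity0_gen x; rewrite !linearZ_LR /= !comaug_hom_com.
Qed.

Lemma comaug_hom_determined (h h' : comaug_hom P Q) : coskeletal 2 Q ->
  h 1%N =1 h' 1%N -> h 2%N =1 h' 2%N -> h = h'.
Proof.
move=> cosk h1 h2; apply: comaug_hom_ext; elim=> [|[|[|n]] IH] x //.
  exact: comaug_hom_0.
apply/eqP; rewrite -subr_eq0; apply/eqP/cosk => // i _.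
by rewrite linearB /= -!comaug_hom_face IH subrr.
Qed.

Section Criterion.
Variable phi : forall n, P n -> Q n.
Hypothesis phi_lin : forall n, linear (phi (n := n)).
Hypothesis phi_face : forall n i (x : P n.+1), (i <= n)%N ->
  face i (phi x) = phi (face i x).
Hypothesis phi_com : forall n, (n <= 2)%N -> phi (com_elt P n) = com_elt Q n.
Hypothesis phi_swap : forall (x : P 2%N),
  phi (op_act x (tperm ord0 ord_max)) = op_act (phi x) (tperm ord0 ord_max).
(** The inner arity is positive because composites with nullary operations are multiples of faces
    and fall under [phi_face]. *)
Hypothesis phi_comp : forall m n p (e : (m + n.+1 = p.+1)%N) (i : 'I_m)
  (x : P m) (y : P n.+1), (p <= 2)%N ->
  phi (op_comp e i x y) = op_comp e i (phi x) (phi y).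
Hypothesis cosk : coskeletal 2 Q.

HB.instance Definition _ n :=
  GRing.isLinear.Build k (P n) (Q n) *:%R (phi (n := n)) (@phi_lin n).

Lemma eq_by_faces n (x y : Q n.+3) :
  (forall i, (i <= n.+2)%N -> face i x = face i y) -> x = y.
Proof.
move=> xy; apply/eqP; rewrite -subr_eq0; apply/eqP/cosk => // i ilt.
by rewrite linearB /= xy // subrr.
Qed.

Lemma ext_com n : phi (com_elt P n) = com_elt Q n.
Proof.
elim: n => [|[|[|n]] IH]; try exact: phi_com.
by apply: eq_by_faces => i ilt; rewrite phi_face // !face_com.
Qed.

Lemma ext_act n (x : P n) s : phi (op_act x s) = op_act (phi x) s.
Proof.
have perm1P m (t : 'S_m) : (forall i, t i = i) -> t = 1%g.
  by move=> tE; apply/permP => i; rewrite perm1.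
elim: n => [|[|[|n]] IH] in x s *.
- by rewrite (perm1P _ s) ?op_act1 // => -[].
- by rewrite (perm1P _ s) ?op_act1 // => i; rewrite !ord1.
- by have [->|->] := perm2_cases s; rewrite ?op_act1 ?phi_swap.
- apply: eq_by_faces => i ilt; rewrite phi_face //.
  have [s' s'P] := face_act s (Ordinal (ilt : (i < n.+3)%N)).
  by rewrite -[i]/(nat_of_ord (Ordinal (ilt : (i < n.+3)%N))) !s'P IH phi_face // -ltnS.
Qed.

(** Induction on the arity of the composite. Above arity 2 the two sides are compared face by face,
    and removing an input of a composite removes it from one of the two factors. *)
Lemma ext_comp m n p (e : (m + n = p.+1)%N) (i : 'I_m) (x : P m) (y : P n) :
  phi (op_comp e i x y) = op_comp e i (phi x) (phi y).
Proof.
elim: p => [|p IH] in m n e i x y *.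
  case: n => [|n] in e y *; last exact: phi_comp.
  case: m => [|m] in e i x *; first by case: i.
  have [? mp] : m = 0%N /\ True by lia.
  subst m; have [c ->] := arity0_gen y.
  by rewrite !(op_compZr, linearZ_LR) /= ext_com !faceE phi_face // -ltnS.
case: n => [|n] in e y *.
  case: m => [|m] in e i x *; first by case: i.
  have mp : m = p.+1 by lia.
  subst m; have [c ->] := arity0_gen y.
  by rewrite !(op_compZr, linearZ_LR) /= ext_com !faceE phi_face // -ltnS.
have [pn|pn] := leqP p.+1 2; first exact: phi_comp.
case: p => [|[|p]] // in IH e pn *.
apply: eq_by_faces => t tlt; rewrite phi_face //.
have := block_pos e i (Ordinal (tlt : (t < p.+3)%N)).
case=> [[r /= tE]|[j ji /= tE]]; rewrite tE.
  have e' : (m + n = p.+3)%N by lia.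
  have rn : (r <= n)%N by rewrite -ltnS.
  by rewrite !(face_comp_in e e') // IH phi_face.
case: m => [|m] in e i j x ji tE *; first by have := ltn_ord i.
have lt_i := ltn_ord i; have lt_j := ltn_ord j.
have i'lt : ((if (j < i)%N then i.-1 else i) < m)%N.
  by move: ji; rewrite -val_eqE /=; case: ifP; lia.
have e' : (m + n.+1 = p.+3)%N by lia.
rewrite !(face_comp_out e e' (i' := Ordinal i'lt)) // IH phi_face //.
Qed.

Lemma comaug_hom_criterion :
  exists h : comaug_hom P Q, forall n (x : P n), h n x = phi x.
Proof.
pose hn n : 'Hom(P n, Q n) := linfun (phi (n := n)).
have hnE n x : hn n x = phi x by rewrite lfunE.
have h_act n (mu : P n) s : hn n (op_act mu s) = op_act (hn n mu) s.
  by rewrite !hnE ext_act.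
have h_one : hn 1%N (op_one P) = op_one Q.
  by rewrite hnE -!com_elt1 ext_com.
have h_comp m n p (e : (m + n = p.+1)%N) i (mu : P m) (nu : P n) :
    hn p (op_comp e i mu nu) = op_comp e i (hn m mu) (hn n nu).
  by rewrite !hnE ext_comp.
pose h := @OperadHom k P Q hn h_act h_one h_comp.
have h_aug : operad_hom_comp h (ca_aug P) = ca_aug Q.
  apply: operad_hom_ext => n c; rewrite comp_lfunE /=.
  have -> : c = c *: (1 : k^o) by rewrite /GRing.scale /= mulr1.
  by rewrite !linearZ_LR /= hnE -/(com_elt P n) ext_com.
by exists (ComaugHom h_aug).
Qed.

End Criterion.

Section Coskeleton.
Variables (phi0 : P 0%N -> Q 0%N) (phi1 : P 1%N -> Q 1%N) (phi2 : P 2%N -> Q 2%N).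

(** The recursive map is handed to the inner match as the argument [psi], because its type depends
    on [n1], which that match refines. *)
Fixpoint cosk_ext n : P n -> Q n :=
  match n return P n -> Q n with
  | 0%N => phi0
  | n1.+1 =>
    match n1 return (P n1 -> Q n1) -> P n1.+1 -> Q n1.+1 with
    | 0%N => fun=> phi1
    | 1%N => fun=> phi2
    | n2.+2 => fun psi x => filler (fun i => psi (face i x)) n2.+2
    end (cosk_ext (n := n1))
  end.

Arguments cosk_ext : simpl never.

Hypotheses (lin0 : linear phi0) (lin1 : linear phi1) (lin2 : linear phi2).
Hypothesis face1 : forall x : P 1%N, face 0 (phi1 x) = phi0 (face 0 x).
Hypothesis face2 : forall i (x : P 2%N), (i <= 1)%N ->
  face i (phi2 x) = phi1 (face i x).

Lemma cosk_ext_linear n : linear (@cosk_ext n).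
Proof.
elim: n => [|[|[|n]] IH] // c x y.
rewrite -[RHS](filler_linear c (fun i => cosk_ext (face i x))
  (fun i => cosk_ext (face i y)) n.+2).
congr (filler _ n.+2); apply/funext => i; rewrite linearP.
exact: IH.
Qed.

Lemma cosk_ext_face n i (x : P n.+1) : (i <= n)%N ->
  face i (cosk_ext x) = cosk_ext (face i x).
Proof.
elim: n => [|[|n] IH] in i x *; first by case: i => // _; apply: face1.
  exact: face2.
move=> ilt; apply: (@face_filler _ _ _ (fun i => cosk_ext (face i x))).
  move=> i1 j1 /andP[ij jn]; rewrite !IH; try lia.
  by rewrite face_face // ij.
by rewrite ilt /=.
Qed.

End Coskeleton.

Lemma comaug_hom_extend (phi0 : P 0%N -> Q 0%N) (phi1 : P 1%N -> Q 1%N)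
    (phi2 : P 2%N -> Q 2%N) :
  linear phi0 -> linear phi1 -> linear phi2 ->
  phi0 (com_elt P 0) = com_elt Q 0 -> phi1 (com_elt P 1) = com_elt Q 1 ->
  phi2 (com_elt P 2) = com_elt Q 2 ->
  (forall x, face 0 (phi1 x) = phi0 (face 0 x)) ->
  (forall i x, (i <= 1)%N -> face i (phi2 x) = phi1 (face i x)) ->
  (forall x, phi2 (op_act x (tperm ord0 ord_max)) =
             op_act (phi2 x) (tperm ord0 ord_max)) ->
  (forall (e : (1 + 1 = 2)%N) i x y,
     phi1 (op_comp e i x y) = op_comp e i (phi1 x) (phi1 y)) ->
  (forall (e : (1 + 2 = 3)%N) i x y,
     phi2 (op_comp e i x y) = op_comp e i (phi1 x) (phi2 y)) ->
  (forall (e : (2 + 1 = 3)%N) i x y,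
     phi2 (op_comp e i x y) = op_comp e i (phi2 x) (phi1 y)) ->
  coskeletal 2 Q ->
  exists h : comaug_hom P Q, h 1%N =1 phi1 /\ h 2%N =1 phi2.
Proof.
move=> l0 l1 l2 c0 c1 c2 f1 f2 sw c11 c12 c21 cosk.
pose phi := cosk_ext phi0 phi1 phi2.
have [||||||h hE] := @comaug_hom_criterion phi; last by exists h; split=> x; rewrite hE.
- exact: cosk_ext_linear.
- by move=> *; apply: cosk_ext_face.
- by case=> [|[|[|]]].
- exact: sw.
- move=> [|[|[|m]]] [|[|n]] [|[|[|p]]] // e i x y _;
    by [case: i | exact: c11 | exact: c12 | exact: c21 | lia].
- exact: cosk.
Qed.

End Extension.

(** * Gelfand-Kirillov dimension *)

Section LimSup.
Variable R : realType.
Implicit Types (u : nat -> R) (d : R).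
Local Open Scope classical_set_scope.

(** The limit superior is an infimum over neighbourhoods of infinity, so a single tail on which the
    bound holds is enough for each [e]. *)
Lemma limn_esup_le u d :
  (forall e, 0 < e -> \forall n \near \oo, u n <= d + e) ->
  (limn_esup (fun n => (u n)%:E) <= d%:E)%E.
Proof.
move=> ud; apply/lee_addgt0Pr => e e0; have [N _ NP] := ud e e0.
apply: (@le_trans _ _ (ereal_sup ((fun n => (u n)%:E) @` [set n | (N <= n)%N]))).
  by apply: ereal_inf_lbound; exists [set n | (N <= n)%N] => //; exists N.
apply: ge_ereal_sup => _ [n nN <-]; rewrite -EFinD lee_fin.
exact: NP.
Qed.

Lemma limn_esup_ge u d :
  (forall e, 0 < e -> \forall n \near \oo, d <= u n + e) ->
  (d%:E <= limn_esup (fun n => (u n)%:E))%E.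
Proof.
move=> ud; apply: le_ereal_inf_tmp => _ [V Voo <-].
apply/lee_addgt0Pr => e e0.
have [n [nV un]] : exists n, V n /\ d <= u n + e.
  have := filterI Voo (ud e e0); move=> [N _ NP].
  by exists N; apply: (NP N) => /=.
apply: (@le_trans _ _ ((u n)%:E + e%:E)%E); first by rewrite -EFinD lee_fin.
by apply: leeD2r; apply: ereal_sup_ubound; exists n.
Qed.

Lemma near_ln_ge (x : R) : \forall n \near \oo, x <= ln n%:R.
Proof.
near=> n; have xn : expR x <= n%:R by near: n; exact: nbhs_infty_ger.
by rewrite -[x]expRK ler_ln // posrE ?expR_gt0 // (lt_le_trans _ xn) ?expR_gt0.
Unshelve. all: by end_near.
Qed.

Lemma near_div_ln (c e : R) : 0 < e -> \forall n \near \oo, c / ln n%:R <= e.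
Proof.
move=> e0; near=> n.
have n1 : 1 <= ln n%:R :> R by near: n; exact: near_ln_ge.
have nc : c / e <= ln n%:R by near: n; exact: near_ln_ge.
by rewrite ler_pdivrMr 1?mulrC -?ler_pdivrMr //; apply: lt_le_trans n1.
Unshelve. all: by end_near.
Qed.

Lemma log_growth_le (S : nat -> nat) (d b : nat) : (forall n, (0 < S n)%N) ->
  (forall n, (S n <= b * n.+1 ^ d)%N) ->
  (limn_esup (fun n => (ln (S n)%:R / ln n%:R : R)%:E) <= d%:R%:E)%E.
Proof.
move=> S0 Sb; apply: limn_esup_le => e e0.
have b0 : (0 < b)%N by move: (S0 0%N) (Sb 0%N); case: b {Sb} => //; lia.
(* From [b * n.+1 ^ d <= b * (2 * n) ^ d] for positive [n]: the quotient of logarithms is at most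
   [d + c / ln n]. *)
pose c : R := ln b%:R + ln 2 *+ d; near=> n.
have n1 : 1 <= ln n%:R :> R by near: n; exact: near_ln_ge.
have ce : c / ln n%:R <= e by near: n; exact: near_div_ln.
have n0 : (0 < n)%N.
  by rewrite lt0n; apply: contraTneq n1 => ->; rewrite ln0 // -ltNge ltr01.
have ln0 : 0 < ln n%:R :> R by apply: lt_le_trans n1.
apply: (@le_trans _ _ (d%:R + c / ln n%:R)); last by rewrite lerD2l.
rewrite ler_pdivrMr // mulrDl divfK ?gt_eqF // mulr_natl /c addrCA -mulrnDl.
rewrite -lnM ?posrE ?ltr0n // -lnXn ?mulr_gt0 ?ltr0n // -lnM ?posrE ?ltr0n //;
  last by rewrite exprn_gt0 // mulr_gt0 ?ltr0n.
rewrite ler_ln ?posrE ?ltr0n ?S0 //; last first.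
  by rewrite !mulr_gt0 ?exprn_gt0 ?mulr_gt0 ?ltr0n.
rewrite -natrM -natrX -natrM ler_nat (leq_trans (Sb n)) // leq_mul2l.
by have [->|d0] := posnP d; rewrite ?orbT // leq_exp2r // orbC; lia.
Unshelve. all: by end_near.
Qed.

(** Each of the [d] factors [n.+1 - i] of the falling factorial is at least half of [n]. *)
Lemma expn_le_bin (n d : nat) : (d.*2 <= n)%N -> (n ^ d <= 2 ^ d * d`! * 'C(n.+1, d))%N.
Proof.
move=> dn; rewrite -mulnA (mulnC d`!) bin_ffact ffact_prod.
rewrite -[X in (n ^ X)%N](card_ord d) -[X in (2 ^ X)%N](card_ord d).
rewrite -!prod_nat_const -big_split /=; apply: leq_prod => i _.
by have := ltn_ord i; lia.
Qed.

Lemma log_growth_ge (S : nat -> nat) (d : nat) : (forall n, ('C(n.+1, d) <= S n)%N) ->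
  (d%:R%:E <= limn_esup (fun n => (ln (S n)%:R / ln n%:R : R)%:E))%E.
Proof.
move=> Sb; apply: limn_esup_ge => e e0.
(* By [expn_le_bin], [n ^ d <= c * S n]; the loss against [d] is thus [ln c / ln n], which tends to
   0. *)
set c := (2 ^ d * d`!)%N.
have c0 : (0 < c)%N by rewrite muln_gt0 expn_gt0 fact_gt0.
near=> n.
have n1 : 1 <= ln n%:R :> R by near: n; exact: near_ln_ge.
have ce : ln c%:R / ln n%:R <= e by near: n; exact: near_div_ln.
have dn : (d.*2 <= n)%N by near: n; exact: nbhs_infty_ge.
have n0 : (0 < n)%N.
  by rewrite lt0n; apply: contraTneq n1 => ->; rewrite ln0 // -ltNge ltr01.
have ln0 : 0 < ln n%:R :> R by apply: lt_le_trans n1.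
have S0 : (0 < S n)%N.
  by rewrite (leq_trans _ (Sb n)) // bin_gt0; lia.
apply: (@le_trans _ _ (ln (S n)%:R / ln n%:R + ln c%:R / ln n%:R)); last first.
  by rewrite lerD2l.
rewrite -mulrDl ler_pdivlMr // mulr_natl -lnXn ?ltr0n // -lnM ?posrE ?ltr0n //.
rewrite ler_ln ?posrE ?exprn_gt0 ?mulr_gt0 ?ltr0n //.
rewrite -natrX -natrM ler_nat mulnC (leq_trans (expn_le_bin dn)) //.
by rewrite leq_mul2l Sb orbT.
Unshelve. all: by end_near.
Qed.

End LimSup.

(** * Counting dimensions by means of the faces *)

Section Growth.
Variables (k : fieldType) (P : comaug_operad k).

(** These spaces interpolate between P(n), for [j = 0], and V_n, for [j = n]. There are no faces in
    arity 0. *)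
Definition faces_ker j n : {vspace P n} :=
  if n is n'.+1 then (\bigcap_(i < j) lker (linfun (@face k P n' i)))%VS
  else fullv.

Lemma faces_kerP j n (x : P n.+1) :
  reflect (forall i, (i < j)%N -> face i x = 0) (x \in faces_ker j n.+1).
Proof.
apply: (iffP idP) => [|xj]; rewrite memvE.
  move=> /subv_bigcapP xj i ij; apply/eqP.
  have := xj (Ordinal ij) isT.
  by rewrite -memvE memv_ker lfunE.
apply/subv_bigcapP => i _; rewrite -memvE memv_ker lfunE /=.
by rewrite xj.
Qed.

(** The face [j] maps [faces_ker j n.+1] onto [faces_ker j n], with [degen j] as a section, and its
    kernel there is [faces_ker j.+1 n.+1]. This is Pascal's recurrence, the source of the binomial
    coefficients. *)
Lemma dim_faces_ker j n : (j <= n)%N ->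
  \dim (faces_ker j n.+1) =
  (\dim (faces_ker j n) + \dim (faces_ker j.+1 n.+1))%N.
Proof.
move=> jn.
rewrite -(limg_ker_dim (linfun (@face k P n j)) (faces_ker j n.+1)) addnC.
congr addn; last by rewrite /faces_ker big_ord_recr.
congr (\dim _).
apply/eqP; rewrite eqEsubv; apply/andP; split; apply/subvP => x.
  move=> /memv_imgP[y yU ->]; rewrite lfunE /=.
  case: n => [|n] in jn x y yU *; first by rewrite memvf.
  apply/faces_kerP => i ij; rewrite face_face; last lia.
  by rewrite (faces_kerP _ _ yU) ?linear0.
move=> xU; rewrite -(face_degen_id x jn) -[face _ _]lfunE.
apply/memv_img/faces_kerP => i ij.
case: n => [|n] in jn x xU *; first by lia.
by rewrite face_degen ?(faces_kerP _ _ xU) ?linear0 //; lia.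
Qed.

Lemma dim_component n : \dim {: P n} = \dim (faces_ker 0 n).
Proof. by case: n => [//|n]; rewrite /faces_ker big_ord0. Qed.

Definition growth n := (\sum_(i < n.+1) \dim {: P i})%N.

Lemma growth_gt0 n : (0 < growth n)%N.
Proof.
rewrite /growth big_ord_recl ltn_addr // lt0n dimv_eq0.
apply: contraNneq (com_elt0_neq0 P) => P0.
by rewrite -memv0 -P0 memvf.
Qed.

Lemma growth_le d : coskeletal d P ->
  exists b, forall n, (growth n <= b * n.+1 ^ d.+1)%N.
Proof.
move=> cosk; pose b := (\sum_(i < d.+1) \dim (faces_ker i i))%N.
(* The bound has to dominate dim V_i on the diagonal, where it may vanish beyond [d], and to satisfy
   [bd j n + bd j.+1 n.+1 <= bd j n.+1] in order to pass through the recurrence. *)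
pose bd j n := (b * (if j <= d then n.+1 ^ (d - j) else 0))%N.
have dimb n j : (j <= n)%N -> (\dim (faces_ker j n) <= bd j n)%N.
  have diag i : (\dim (faces_ker i i) <= bd i i)%N.
    rewrite /bd; have [id|di] := leqP i d.
      rewrite -[leqLHS]muln1 leq_mul ?expn_gt0 //.
      by rewrite /b (bigD1 (Ordinal (id : (i < d.+1)%N))) //= leq_addr.
    rewrite muln0 leqn0 dimv_eq0 -subv0; apply/subvP => x.
    case: i => [|i] in di x *; first by [].
    by move=> /faces_kerP x0; rewrite memv0; apply/eqP/cosk => //; lia.
  elim: n => [|n IHn] in j * => jn.
    by have -> : j = 0%N by lia.
  have [q qE] : exists q, (j + q = n.+1)%N by exists (n.+1 - j)%N; lia.
  elim: q => [|q IHq] in j jn qE *.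
    by have -> : j = n.+1 by lia.
  rewrite dim_faces_ker; last lia.
  apply: leq_trans (leq_add (IHn j _) (IHq j.+1 _ _)) _; try lia.
  rewrite /bd -mulnDr leq_mul2l; apply/orP; right.
  case: (ltngtP j d) => [jd|//|->]; last by rewrite !subnn.
  have -> : (d - j = (d - j.+1).+1)%N by lia.
  rewrite !expnS [in leqRHS]mulSn addnC leq_add2l leq_mul2l.
  by have [->|e0] := posnP (d - j.+1)%N; rewrite // leq_exp2r // leqnSn.
exists b => n; apply: (@leq_trans (\sum_(i < n.+1) b * n.+1 ^ d)%N).
  apply: leq_sum => i _; rewrite dim_component.
  apply: leq_trans (dimb i 0%N _) _; rewrite // /bd subn0 leq_mul2l.
  have [->|d0] := posnP d; first by rewrite orbT.
  by rewrite leq_exp2r // ltn_ord orbT.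
by rewrite sum_nat_const card_ord expnS mulnCA.
Qed.

(** The element [x] starts Pascal's recurrence at [faces_ker d.+1 d.+1]; at [j = 0] this gives dim
    P(n) at least C(n, d+1), and the sum over arities gives C(n+1, d+2). *)
Lemma growth_ge d (x : P d.+1) : (forall i, (i <= d)%N -> face i x = 0) ->
  x != 0 -> forall n, ('C(n.+1, d.+2) <= growth n)%N.
Proof.
move=> x0 xn0.
have dimb n j : (j <= n)%N -> (j <= d.+1)%N ->
    ('C(n - j, d.+1 - j) <= \dim (faces_ker j n))%N.
  have diag i : (i <= d.+1)%N -> ('C(i - i, d.+1 - i) <= \dim (faces_ker i i))%N.
    rewrite leq_eqVlt => /predU1P[->|id]; last by rewrite bin_small //; lia.
    rewrite !subnn bin0 lt0n dimv_eq0; apply: contraNneq xn0 => K0.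
    by rewrite -memv0 -K0; apply/faces_kerP.
  elim: n => [|n IHn] in j * => jn jd.
    have j0 : j = 0%N by lia.
    by rewrite j0; apply: diag.
  have [q qE] : exists q, (j + q = n.+1)%N by exists (n.+1 - j)%N; lia.
  elim: q => [|q IHq] in j jn jd qE *.
    have jE : j = n.+1 by lia.
    by rewrite jE diag // -jE.
  rewrite dim_faces_ker; last lia.
  have [jd'|dj] := ltnP j d.+1; last first.
    have -> : j = d.+1 by lia.
    rewrite subnn bin0 ltn_addr //.
    by apply: leq_trans (IHn d.+1 _ _); rewrite ?subnn ?bin0 //; lia.
  have -> : (n.+1 - j = (n - j).+1)%N by lia.
  have -> : (d.+1 - j = (d - j).+1)%N by lia.
  rewrite binS; apply: leq_add.
    by have := IHn j; rewrite (_ : d.+1 - j = (d - j).+1)%N; [apply|]; lia.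
  by have := IHq j.+1; rewrite !subSS; apply; lia.
elim=> [|n IHn]; first by rewrite bin_small.
rewrite binS /growth big_ord_recr /=; apply: leq_add IHn _.
by have := dimb n.+1 0%N; rewrite !subn0 dim_component; apply.
Qed.

Lemma GKdim_le (R : realType) d : coskeletal d P -> (GKdim R P <= d.+1%:R%:E)%E.
Proof. by move=> /growth_le[b bP]; apply: log_growth_le growth_gt0 bP. Qed.

Lemma GKdim_ge (R : realType) d (x : P d.+1) :
  (forall i, (i <= d)%N -> face i x = 0) -> x != 0 ->
  (d.+2%:R%:E <= GKdim R P)%E.
Proof. by move=> x0 xn0; apply: log_growth_ge; apply: growth_ge x0 xn0. Qed.

(** A nonzero element of V_(n+1) with n at least 2 would force the dimension to be at least 4. *)
Lemma GKdim3_coskeletal (R : realType) : GKdim R P = 3%:E -> coskeletal 2 P.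
Proof.
move=> gk n x n2 x0; apply/eqP; apply: contraT => /(GKdim_ge R x0).
by rewrite gk lee_fin ler_nat; lia.
Qed.

(** If V_2 vanished too, the operad would be 1-coskeletal and of dimension at most 2. *)
Lemma GKdim3_primitive (R : realType) : GKdim R P = 3%:E ->
  exists x : P 2%N, [/\ face 0 x = 0, face 1 x = 0 & x != 0].
Proof.
move=> gk; apply: contrapT => noprim.
suff /(GKdim_le R) : coskeletal 1 P by rewrite gk lee_fin ler_nat.
move=> [|[|n]] // x _ x0; last by apply: (GKdim3_coskeletal gk).
apply/eqP; apply: contraT => xn0; case: noprim.
by exists x; split=> //; apply: x0.
Qed.

Lemma GKdim3 (R : realType) (x : P 2%N) : coskeletal 2 P ->
  face 0 x = 0 -> face 1 x = 0 -> x != 0 -> GKdim R P = 3%:E.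
Proof.
move=> cosk x0 x1 xn0; apply/eqP; rewrite eq_le GKdim_le //=.
by apply: (GKdim_ge R _ xn0) => -[|[|]].
Qed.

End Growth.

(** * The operad of a trident algebra *)

(** Provides the rewrite rules of a linear map to a function known only through a proof of
    [linear h]. *)
Lemma linE (k : fieldType) (U V : lmodType k) (h : U -> V) : linear h ->
  (forall u v, h (u + v) = h u + h v) * (forall u, h (- u) = - h u) *
  (forall c u, h (c *: u) = c *: h u) * (h 0 = 0).
Proof.
move=> hl; pose H := GRing.isLinear.Build k U V *:%R h hl.
pose hL : {linear U -> V} := HB.pack h H.
split; [split; [split|]|].
- exact: (linearD hL).
- exact: (linearN hL).
- exact: (linearZ_LR hL).
- exact: (linear0 hL).
Qed.

Lemma linEl (k : fieldType) (U V : lmodType k) (W : Type) (h : U -> W -> V) :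
  (forall w, linear (fun u => h u w)) ->
  (forall u v w, h (u + v) w = h u w + h v w) *
  (forall u w, h (- u) w = - h u w) *
  (forall c u w, h (c *: u) w = c *: h u w) * (forall w, h 0 w = 0).
Proof.
move=> hl; split; [split; [split|]|] => *; [exact: (linE (hl _)).1.1.1
  |exact: (linE (hl _)).1.1.2|exact: (linE (hl _)).1.2|exact: (linE (hl _)).2].
Qed.

(* Reduces an identity in a vector space to identities in k, where the tactic
   ring is available. *)
Lemma eq_by_functionals (k : fieldType) (V : vectType k) (u v : V) :
  (forall phi : V -> k, (forall x y, phi (x + y) = phi x + phi y) ->
     (forall x, phi (- x) = - phi x) -> (forall c x, phi (c *: x) = c * phi x) ->
     phi u = phi v) -> u = v.
Proof.
move=> uv; rewrite (coord_vbasis (memvf u)) (coord_vbasis (memvf v)).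
apply: eq_bigr => i _; congr (_ *: _).
apply: (uv (fun x => coord (vbasis {:V}) i x)) => *.
- exact: linearD.
- exact: linearN.
- exact: linearZ_LR.
Qed.

(** Uses a known equation [c = d] to prove [a = b]; what remains, [a - b = c - d] without
    subtractions, is a goal for [ring]. *)
Lemma eq_shift (V : zmodType) (a b c d : V) : c = d -> a + d = b + c -> a = b.
Proof. by move=> -> /addIr. Qed.

Lemma vsval_inj (k : fieldType) (V : vectType k) (U : {vspace V})
  (x y : subvs_of U) : vsval x = vsval y -> x = y.
Proof. exact: val_inj. Qed.

Lemma vsval_linear (k : fieldType) (V : vectType k) (U : {vspace V}) :
  linear (vsval : subvs_of U -> V).
Proof. by []. Qed.

(** * Identities in a trident algebra *)

Section TridentLaws.
Variables (k : fieldType) (T : trident k).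
Local Notation A := (td_alg T).
Local Notation M := (td_mod T).
Local Notation Abar := (subvs_of (aug_ideal (td_eps T))).
Implicit Types (x y z a b : A) (mu : M).

Definition aug x : k := td_eps T x.

Lemma aug_linear c x y : aug (c *: x + y) = c * aug x + aug y.
Proof. by rewrite /aug linearP. Qed.

Lemma augD x y : aug (x + y) = aug x + aug y.
Proof. by rewrite /aug linearD. Qed.

Lemma augN x : aug (- x) = - aug x.
Proof. by rewrite /aug linearN. Qed.

Lemma augZ c x : aug (c *: x) = c * aug x.
Proof. by rewrite /aug linearZ_LR. Qed.

Lemma augM x y : aug (x * y) = aug x * aug y.
Proof. by rewrite /aug rmorphM. Qed.

Lemma aug1 : aug 1 = 1.
Proof. by rewrite /aug rmorph1. Qed.

Definition augE := (augD, augN, augZ, augM, aug1).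

Lemma mem_aug_ideal x : (x \in aug_ideal (td_eps T)) = (aug x == 0).
Proof. by rewrite memv_ker. Qed.

Lemma aug_vsval (x : Abar) : aug (vsval x) = 0.
Proof. by apply/eqP; rewrite -mem_aug_ideal subvsP. Qed.

Definition abar x : Abar := vsproj _ (x - aug x *: 1).

Lemma abarE x : vsval (abar x) = x - aug x *: 1.
Proof. by rewrite vsprojK // mem_aug_ideal !augE mulr1 subrr. Qed.

Lemma abar_linear : linear abar.
Proof.
move=> c x y; apply: vsval_inj; rewrite vsval_linear !abarE aug_linear.
by rewrite scalerDl scalerBr opprD scalerA addrACA.
Qed.

Lemma abar_vsval (x : Abar) : abar (vsval x) = x.
Proof. by apply: vsval_inj; rewrite abarE aug_vsval scale0r subr0. Qed.

Lemma abar1 : abar 1 = 0.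
Proof. by apply: vsval_inj; rewrite abarE linear0 aug1 scale1r subrr. Qed.

Lemma abarMr x c : abar (x * c) = aug_mulr (abar x) c + aug x *: abar c.
Proof.
apply: vsval_inj; rewrite !(linE (@vsval_linear _ _ _)) /= !abarE augM.
by rewrite mulrBl -scalerAl mul1r scalerBr scalerA subrKA.
Qed.

Definition la x mu : M := td_lact x mu.
Definition rl mu a : M := td_ract mu a 1.
Definition rr mu b : M := td_ract mu 1 b.
Definition sw mu : M := td_act mu (tperm ord0 ord_max).
(** [f] and [g] are extended to all of A by 0 on the unit, which frees the formulas from membership
    in the ideal. The price is the terms in [aug] below, since [abar] is not multiplicative. *)
Definition fA x : M := td_f (abar x).
Definition gA x y : M := td_g (abar x) (abar y).

Lemma la_linr x : linear (la x).
Proof. exact: td_lact_linr. Qed.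

Lemma la_linl mu : linear (fun x => la x mu).
Proof. exact: td_lact_linl. Qed.

Lemma rl_linl a : linear (fun mu => rl mu a).
Proof. exact: td_ract_lin. Qed.

Lemma rl_linr mu : linear (rl mu).
Proof. exact: (td_ract_linl mu 1). Qed.

Lemma rr_linl a : linear (fun mu => rr mu a).
Proof. exact: td_ract_lin. Qed.

Lemma rr_linr mu : linear (rr mu).
Proof. exact: (td_ract_linr mu 1). Qed.

Lemma sw_lin : linear sw.
Proof. by case: (@td_actP _ T) => /(_ (tperm ord0 ord_max)). Qed.

Lemma fA_lin : linear fA.
Proof. by move=> c x y; rewrite /fA (linE abar_linear) (linE abar_linear) td_f_lin. Qed.

Lemma gA_linl y : linear (fun x => gA x y).
Proof.
by move=> c x x'; rewrite /gA (linE abar_linear) (linE abar_linear) td_g_linl.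
Qed.

Lemma gA_linr x : linear (gA x).
Proof.
by move=> c y y'; rewrite /gA (linE abar_linear) (linE abar_linear) td_g_linr.
Qed.

Definition mlin := (fun x => linE (la_linr x), linEl la_linl, linEl rl_linl,
  fun mu => linE (rl_linr mu), linEl rr_linl, fun mu => linE (rr_linr mu),
  linE sw_lin, linE fA_lin, linEl gA_linl, fun x => linE (gA_linr x)).

Lemma la1 mu : la 1 mu = mu. Proof. exact: td_lact1. Qed.
Lemma laM x y mu : la (x * y) mu = la x (la y mu). Proof. exact: td_lactM. Qed.
Lemma rl1 mu : rl mu 1 = mu. Proof. exact: td_ract1. Qed.
Lemma rr1 mu : rr mu 1 = mu. Proof. exact: td_ract1. Qed.

Lemma rlM mu a b : rl mu (a * b) = rl (rl mu a) b.
Proof. by rewrite /rl -td_ractM mulr1. Qed.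

Lemma rrM mu a b : rr mu (a * b) = rr (rr mu a) b.
Proof. by rewrite /rr -td_ractM mulr1. Qed.

Lemma ractE mu a b : td_ract mu a b = rr (rl mu a) b.
Proof. by rewrite /rr /rl -td_ractM mulr1 mul1r. Qed.

Lemma rl_rr mu a b : rl (rr mu b) a = rr (rl mu a) b.
Proof. by rewrite -ractE /rl /rr -td_ractM mulr1 mul1r. Qed.

Lemma rl_la x mu a : rl (la x mu) a = la x (rl mu a).
Proof. exact/esym/td_lract. Qed.

Lemma rr_la x mu a : rr (la x mu) a = la x (rr mu a).
Proof. exact/esym/td_lract. Qed.

Lemma sw_la x mu : sw (la x mu) = la x (sw mu).
Proof. exact/esym/td_lact_act. Qed.

Lemma sw_rl mu a : sw (rl mu a) = rr (sw mu) a.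
Proof. exact: td_ract_act. Qed.

Lemma sw_rr mu a : sw (rr mu a) = rl (sw mu) a.
Proof. exact: td_ract_act. Qed.

Lemma sw_sw mu : sw (sw mu) = mu.
Proof.
by case: (@td_actP _ T) => _ t1 tM; rewrite /sw -tM tperm2 t1.
Qed.

Lemma sw_fA x : sw (fA x) = fA x. Proof. exact: td_f_act. Qed.
Lemma sw_gA x y : sw (gA x y) = gA y x. Proof. exact: td_g_act. Qed.

Lemma fA1 : fA 1 = 0.
Proof. by rewrite /fA abar1 (linE (@td_f_lin _ T)). Qed.

Lemma gA1l y : gA 1 y = 0.
Proof. by rewrite /gA abar1 (linEl (@td_g_linl _ T)). Qed.

Lemma gA1r x : gA x 1 = 0.
Proof. by rewrite /gA abar1 (linE (@td_g_linr _ T _)). Qed.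

Lemma aug_mulr1 (x : Abar) : aug_mulr x 1 = x.
Proof. by apply: vsval_inj; rewrite /= mulr1. Qed.

Lemma g_aug_mulr_l (a b : Abar) c : td_g (aug_mulr a c) b = rl (td_g a b) c.
Proof. by rewrite /rl -td_g_ract aug_mulr1. Qed.

Lemma g_aug_mulr_r (a b : Abar) c : td_g a (aug_mulr b c) = rr (td_g a b) c.
Proof. by rewrite /rr -td_g_ract aug_mulr1. Qed.

Lemma rl_gA x y a : rl (gA x y) a = gA (x * a) y - aug x *: gA a y.
Proof.
by rewrite /gA abarMr !(linEl (@td_g_linl _ T)) g_aug_mulr_l addrK.
Qed.

Lemma rr_gA x y a : rr (gA x y) a = gA x (y * a) - aug y *: gA x a.
Proof.
by rewrite /gA abarMr !(linE (@td_g_linr _ T _)) g_aug_mulr_r addrK.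
Qed.

Lemma fAM x y :
  fA (x * y) = la x (fA y) + rl (fA x) y + rr (fA x) y - aug y *: fA x
    + gA x y + gA y x.
Proof.
(* With bars for [abar], the bar of [x * y] is the product of the bars plus [aug y] times the bar of
   [x] plus [aug x] times the bar of [y]. *)
have -> : fA (x * y) = td_f (aug_mulr (abar x) (vsval (abar y)))
    + aug y *: fA x + aug x *: fA y.
  rewrite /fA -!(linE (@td_f_lin _ T)).1.2 -!(linE (@td_f_lin _ T)).1.1.1.
  congr td_f; apply: vsval_inj; rewrite !(linE (@vsval_linear _ _ _)) /= !abarE augM.
  rewrite mulrBl !mulrBr -!scalerAl -!scalerAr !mul1r mulr1.
  apply: eq_by_functionals => phi pD pN pZ; rewrite !(pD, pN, pZ); ring.
rewrite td_fM !abarE -/(fA x) -/(fA y) -/(gA x y) -/(gA y x).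
rewrite -/(la _ _) -/(rl _ _) -/(rr _ _) !mlin la1 rl1 rr1.
by apply: eq_by_functionals => phi pD pN pZ; rewrite !(pD, pN, pZ); ring.
Qed.

(** The second trident identity, oriented so as to eliminate two-sided actions on [fA x]; the terms
    in [aug] come from expanding [abar]. *)
Lemma fA_ract x y z :
  rr (rl (fA x) y) z =
  aug y *: rr (fA x) z + aug z *: rl (fA x) y - (aug y * aug z) *: fA x
  + la x (gA y z) - gA (x * y) z - gA y (x * z)
  + aug y *: gA x z + aug z *: gA y x + aug x *: gA y z.
Proof.
have := @td_f_ract _ T (abar x) (abar y) (abar z).
rewrite -/(fA x) -/(gA y z) ractE !abarE -/(la _ _) !mlin la1 rl1 rr1 => fE.
have gl v : td_g (aug_mulr (abar x) (vsval (abar y))) (abar v) =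
    gA (x * y) v - aug x *: gA y v - aug y *: gA x v.
  by rewrite g_aug_mulr_l abarE !mlin rl1 -/(gA x v) rl_gA.
have gr v : td_g (abar v) (aug_mulr (abar x) (vsval (abar z))) =
    gA v (x * z) - aug x *: gA v z - aug z *: gA v x.
  by rewrite g_aug_mulr_r abarE !mlin rr1 -/(gA v x) rr_gA.
rewrite abarE in gl; rewrite abarE in gr.
move: fE; rewrite gl gr rr1 => fE; apply: eq_by_functionals => phi pD pN pZ.
have := congr1 phi fE; rewrite !(pD, pN, pZ) => /eq_shift; apply; ring.
Qed.

End TridentLaws.

(** * The bimodule of binary operations *)

Section ArityTwo.
Variables (k : fieldType) (T : trident k).
Local Notation A := (td_alg T).
Local Notation M := (td_mod T).
Implicit Types (x y z : A) (mu : M).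

(* (a, b, mu) with aug a = aug b stands for the binary operation whose
   restrictions to its two inputs are a and b, namely
   c 1_2 + 1_2 (abar a, 1) + 1_2 (1, abar b) + mu where c = aug a. The formulas
   below for the partial composites with unary operations are forced by
   x o 1_2 = f x + 1_2 (x, 1) + 1_2 (1, x) and 1_2 (x, y) = g x y. *)
Definition elt : Type := (A * A * M)%type.
Implicit Types e : elt.

Definition elt_wf e := aug e.1.1 = aug e.1.2.

Definition lact x e : elt :=
  (x * e.1.1, x * e.1.2,
   la x e.2 + rl (fA x) e.1.1 + rr (fA x) e.1.2 - aug e.1.1 *: fA x
   + gA e.1.1 x + gA x e.1.2).

Definition ract1 e y : elt :=
  (e.1.1 * y, aug y *: e.1.2, rl e.2 y + gA y e.1.2).

Definition ract2 e z : elt :=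
  (aug z *: e.1.1, e.1.2 * z, rr e.2 z + gA e.1.1 z).

Definition esw e : elt := (e.1.2, e.1.1, sw e.2).

Definition escale (c : k) e : elt := (c *: e.1.1, c *: e.1.2, c *: e.2).

Lemma elt_eq e e' : e.1.1 = e'.1.1 -> e.1.2 = e'.1.2 -> e.2 = e'.2 -> e = e'.
Proof. by case: e => -[a b] mu; case: e' => -[a' b'] mu' /= -> -> ->. Qed.

Lemma lact1 e : lact 1 e = e.
Proof.
by apply: elt_eq; rewrite /= ?mul1r // la1 fA1 gA1l gA1r !mlin scaler0 subr0 !addr0.
Qed.

(** Associativity of the left action is where both trident identities enter: [fAM] expands
    [fA (x * y)], and [fA_ract] the two-sided actions on [fA]. *)
Lemma lactM x y e : elt_wf e -> lact (x * y) e = lact x (lact y e).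
Proof.
rewrite /elt_wf; case: e => -[a b] mu /= wf.
apply: elt_eq; rewrite /= ?mulrA // !augE laM !fAM !mlin.
rewrite !(rl_la, rr_la, rl_rr, rl_gA, rr_gA) -!(rlM, rrM) !fA_ract.
apply: eq_by_functionals => phi pD pN pZ; rewrite !(pD, pN, pZ) -wf; ring.
Qed.

Lemma ract1_1 e : ract1 e 1 = e.
Proof. by apply: elt_eq; rewrite /= ?mulr1 ?aug1 ?scale1r // rl1 gA1l addr0. Qed.

Lemma ract2_1 e : ract2 e 1 = e.
Proof. by apply: elt_eq; rewrite /= ?mulr1 ?aug1 ?scale1r // rr1 gA1r addr0. Qed.

Lemma ract1M e y z : ract1 e (y * z) = ract1 (ract1 e y) z.
Proof.
apply: elt_eq; rewrite /= ?mulrA ?scalerA ?augM 1?[_ z * _]mulrC //.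
rewrite !mlin rlM rl_gA.
by apply: eq_by_functionals => phi pD pN pZ; rewrite !(pD, pN, pZ); ring.
Qed.

Lemma ract2M e y z : ract2 e (y * z) = ract2 (ract2 e y) z.
Proof.
apply: elt_eq; rewrite /= ?mulrA ?scalerA ?augM 1?[_ z * _]mulrC //.
rewrite !mlin rrM rr_gA.
by apply: eq_by_functionals => phi pD pN pZ; rewrite !(pD, pN, pZ); ring.
Qed.

Lemma ract12 e y z : elt_wf e -> ract2 (ract1 e y) z = ract1 (ract2 e z) y.
Proof.
rewrite /elt_wf => wf; apply: elt_eq; rewrite /= -?scalerAl //.
rewrite !mlin rl_rr rl_gA rr_gA wf.
by apply: eq_by_functionals => phi pD pN pZ; rewrite !(pD, pN, pZ); ring.
Qed.

Lemma lact_ract1 x e y : elt_wf e -> lact x (ract1 e y) = ract1 (lact x e) y.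
Proof.
rewrite /elt_wf => wf; apply: elt_eq; rewrite /= ?mulrA -?scalerAr // !augE !mlin.
rewrite !(rl_la, rr_la, rl_rr, rl_gA, rr_gA) -!(rlM, rrM) !fA_ract wf.
by apply: eq_by_functionals => phi pD pN pZ; rewrite !(pD, pN, pZ); ring.
Qed.

Lemma esw_lact x e : elt_wf e -> esw (lact x e) = lact x (esw e).
Proof.
rewrite /elt_wf => wf; apply: elt_eq; rewrite //= !mlin.
rewrite !(sw_la, sw_rl, sw_rr, sw_fA, sw_gA) wf.
by apply: eq_by_functionals => phi pD pN pZ; rewrite !(pD, pN, pZ); ring.
Qed.

Lemma esw_ract1 e y : esw (ract1 e y) = ract2 (esw e) y.
Proof. by apply: elt_eq; rewrite //= !mlin sw_rl sw_gA. Qed.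

Lemma esw_ract2 e y : esw (ract2 e y) = ract1 (esw e) y.
Proof. by apply: elt_eq; rewrite //= !mlin sw_rr sw_gA. Qed.

Lemma esw_esw e : esw (esw e) = e.
Proof. by apply: elt_eq; rewrite //= sw_sw. Qed.

Lemma esw_scale c e : esw (escale c e) = escale c (esw e).
Proof. by apply: elt_eq; rewrite //= !mlin. Qed.

Lemma lact_ract2 x e y : elt_wf e -> lact x (ract2 e y) = ract2 (lact x e) y.
Proof.
move=> wf; have wf' : elt_wf (esw e) by [].
rewrite -[e]esw_esw -esw_ract1 -esw_lact; last first.
  by rewrite /elt_wf /= !augE wf mulrC.
by rewrite lact_ract1 // esw_ract1 esw_lact.
Qed.

Lemma lact_scale c x e : lact x (escale c e) = escale c (lact x e).
Proof.
apply: elt_eq; rewrite /= -?scalerAr // !augE !mlin.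
by apply: eq_by_functionals => phi pD pN pZ; rewrite !(pD, pN, pZ); ring.
Qed.

Lemma ract1_scale c e y : ract1 (escale c e) y = escale c (ract1 e y).
Proof.
apply: elt_eq; rewrite /= -?scalerAl ?scalerA // 1?mulrC // !mlin.
by apply: eq_by_functionals => phi pD pN pZ; rewrite !(pD, pN, pZ); ring.
Qed.

Lemma ract2_scale c e y : ract2 (escale c e) y = escale c (ract2 e y).
Proof.
by rewrite -[LHS]esw_esw esw_ract2 esw_scale ract1_scale esw_scale esw_ract1 esw_esw. Qed.

Lemma escaleM c d e : escale c (escale d e) = escale (c * d) e.
Proof. by apply: elt_eq; rewrite /= scalerA. Qed.

Lemma lact_scalar c x e : lact (c *: x) e = escale c (lact x e).
Proof.
apply: elt_eq; rewrite /= -?scalerAl // !mlin.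
by apply: eq_by_functionals => phi pD pN pZ; rewrite !(pD, pN, pZ); ring.
Qed.

Lemma ract1_scalar c e y : ract1 e (c *: y) = escale c (ract1 e y).
Proof.
apply: elt_eq; rewrite /= -?scalerAr ?augE ?scalerA // !mlin.
by apply: eq_by_functionals => phi pD pN pZ; rewrite !(pD, pN, pZ); ring.
Qed.

Lemma ract2_scalar c e y : ract2 e (c *: y) = escale c (ract2 e y).
Proof.
by rewrite -[LHS]esw_esw esw_ract2 ract1_scalar esw_scale esw_ract1 esw_esw. Qed.

End ArityTwo.

(** * Operations described by their restrictions to one and two inputs *)

Section Carrier.
Variables (k : fieldType) (T : trident k).
Local Notation A := (td_alg T).
Local Notation M := (td_mod T).
Local Notation Abar := (subvs_of (aug_ideal (td_eps T))).

Definition pairs n : finType := {p : 'I_n * 'I_n | (p.1 < p.2)%N}.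

(* Every operation is the sum of c 1_n, of an operation 1_n o_i a for each input
   i with a in Abar, and of an operation with value in M for each pair of inputs,
   extended by inputs that it ignores. *)
Definition tcarrier n : vectType k :=
  (k^o * {ffun 'I_n -> Abar} * {ffun pairs n -> M})%type.

Section Components.
Variable n : nat.
Implicit Types X Y : tcarrier n.

Definition cf X : k := X.1.1.
(** Inputs are natural numbers, so that composites need no arithmetic of ordinals. With the default
    value 0, [av X t] is [cf X *: 1] out of range, and [aug_av] and [ev_wf] hold for every [t]. *)
Definition bf X t : Abar := if insub t is Some i then X.1.2 i else 0.
Definition av X t : A := cf X *: 1 + vsval (bf X t).
Definition m0 X t u : M :=
  if [pick p : pairs n | ((val p).1 == t :> nat) && ((val p).2 == u :> nat)]
  is Some p then X.2 p else 0.
Definition mv X t u : M :=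
  if (t < u)%N then m0 X t u else if (u < t)%N then sw (m0 X u t) else 0.
Definition ev X t u : elt T := (av X t, av X u, mv X t u).

Lemma cf_lin c X Y : cf (c *: X + Y) = c * cf X + cf Y.
Proof. by []. Qed.

Lemma av_lin c X Y t : av (c *: X + Y) t = c *: av X t + av Y t.
Proof.
have bf_lin : bf (c *: X + Y) t = c *: bf X t + bf Y t.
  by rewrite /bf; case: insubP => [i _ _|_]; rewrite ?scaler0 ?addr0 // !ffunE.
rewrite /av bf_lin vsval_linear cf_lin scalerDr scalerDl scalerA.
by rewrite addrACA.
Qed.

Lemma mv_lin c X Y t u : mv (c *: X + Y) t u = c *: mv X t u + mv Y t u.
Proof.
have m0_lin t' u' : m0 (c *: X + Y) t' u' = c *: m0 X t' u' + m0 Y t' u'.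
  by rewrite /m0; case: pickP => [p _|_]; rewrite ?scaler0 ?addr0 // !ffunE.
rewrite /mv !m0_lin; case: ifP => // _; case: ifP => _; first exact: sw_lin.
by rewrite scaler0 addr0.
Qed.

Lemma aug_av X t : aug (av X t) = cf X.
Proof. by rewrite /av augD augZ aug1 mulr1 aug_vsval addr0. Qed.

Lemma ev_wf X t u : elt_wf (ev X t u).
Proof. by rewrite /elt_wf /= !aug_av. Qed.

Lemma esw_ev X t u : esw (ev X t u) = ev X u t.
Proof.
apply: elt_eq => //=; rewrite /mv.
by case: ltngtP; rewrite ?sw_sw ?mlin.
Qed.

Lemma tcarrier_eq X Y : cf X = cf Y ->
  (forall t, (t < n)%N -> av X t = av Y t) ->
  (forall t u, (t < u)%N -> (u < n)%N -> mv X t u = mv Y t u) -> X = Y.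
Proof.
case: X => -[c b] m; case: Y => -[c' b'] m' cE aE mE.
have {cE} cE : c = c' := cE; subst c'.
have -> : b = b'.
  apply/ffunP => i; apply: vsval_inj; have := aE i (ltn_ord i).
  by rewrite /av /bf /= valK => /addrI.
have -> // : m = m'.
apply/ffunP => p; have := mE (val p).1 (val p).2 (valP p) (ltn_ord _).
rewrite /mv (valP p) /m0; case: pickP => [q /andP[/eqP q1 /eqP q2]|/(_ p)].
  have -> // : q = p.
  apply: val_inj; case: (val q) (val p) q1 q2 => [i j] [i' j'] /=.
  by move=> /val_inj -> /val_inj ->.
by rewrite !eqxx.
Qed.

Variables (c : k) (a : nat -> A) (m : nat -> nat -> M).

(** Only the bars of [a] and the increasing pairs of [m] are kept; [av_mk] and [mv_mk] recover the
    rest from the compatibilities that restrictions of an operation satisfy. *)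
Definition tmk : tcarrier n :=
  (c : k^o, [ffun i : 'I_n => abar (a i)],
   [ffun p : pairs n => m (val p).1 (val p).2]).

Lemma cf_mk : cf tmk = c. Proof. by []. Qed.

Lemma av_mk t : (t < n)%N -> aug (a t) = c -> av tmk t = a t.
Proof.
move=> tn; rewrite /av /bf; case: insubP => [i _ <- ac|]; last by rewrite tn.
by rewrite cf_mk ffunE abarE [aug _]ac subrKC.
Qed.

Lemma mv_mk t u : (t < n)%N -> (u < n)%N -> t != u -> m u t = sw (m t u) ->
  mv tmk t u = m t u.
Proof.
have m0E t' u' : (t' < u')%N -> (u' < n)%N -> m0 tmk t' u' = m t' u'.
  move=> tu' un'; rewrite /m0; case: pickP => [p /andP[/eqP <- /eqP <-]|].
    by rewrite ffunE.
  have tn' : (t' < n)%N by lia.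
  have tup : ((Ordinal tn', Ordinal un').1 < (Ordinal tn', Ordinal un').2)%N by [].
  by move=> /(_ (exist _ (Ordinal tn', Ordinal un') tup)); rewrite /= !eqxx.
move=> tn un tu msym; rewrite /mv; case: ltngtP tu => // ltu _.
  by rewrite m0E.
by rewrite m0E // msym sw_sw.
Qed.

End Components.
End Carrier.

(** * Partial composition *)

Section TridentOperad.
Variables (k : fieldType) (T : trident k).
Local Notation A := (td_alg T).
Local Notation M := (td_mod T).
Local Notation tc := (tcarrier T).

Section Composition.
Variables (m n : nat) (i : nat) (X : tc m) (Y : tc n).

(** Outside the block this inverts [outer_pos i n]. *)
Definition outer_idx t := if (t < i)%N then t else (t.+1 - n)%N.
Definition in_block t := (i <= t < i + n)%N.

Definition ca t : A :=
  if in_block t then av X i * av Y (t - i) else cf Y *: av X (outer_idx t).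

(** Restriction of the composite to two inputs. If both lie in the block, [X] is seen only through
    its input [i] and acts from the left; if one does, [Y] is seen through that input and acts from
    the right; if none does, [Y] leaves its scalar. *)
Definition ce t u : elt T :=
  if in_block t then
    if in_block u then lact (av X i) (ev Y (t - i) (u - i))
    else ract1 (ev X i (outer_idx u)) (av Y (t - i))
  else
    if in_block u then ract2 (ev X (outer_idx t) i) (av Y (u - i))
    else escale (cf Y) (ev X (outer_idx t) (outer_idx u)).

Lemma ce1 t u : (ce t u).1 = (ca t, ca u).
Proof. by rewrite /ce /ca; do 2!case: ifP => _ //=; rewrite ?aug_av. Qed.

Lemma esw_ce t u : esw (ce t u) = ce u t.
Proof.
rewrite /ce; do 2!case: ifP => _.
- by rewrite esw_lact ?esw_ev //; apply: ev_wf.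
- by rewrite esw_ract1 esw_ev.
- by rewrite esw_ract2 esw_ev.
- by rewrite esw_scale esw_ev.
Qed.

Lemma aug_ca t : aug (ca t) = cf X * cf Y.
Proof. by rewrite /ca; case: ifP => _; rewrite ?augM ?augZ !aug_av // mulrC. Qed.

Lemma in_block_in r : (r < n)%N -> in_block (i + r).
Proof. by rewrite /in_block; lia. Qed.

Lemma in_block_out j : j != i -> in_block (outer_pos i n j) = false.
Proof. by rewrite /in_block /outer_pos; case: ifP; lia. Qed.

Lemma outer_idxK j : j != i -> outer_idx (outer_pos i n j) = j.
Proof.
by rewrite /outer_idx /outer_pos; case: (ltnP j i); case: ifP => //; lia.
Qed.

End Composition.

Definition tcomp m n p i (X : tc m) (Y : tc n) : tc p :=
  tmk p (cf X * cf Y) (ca i X Y) (fun t u => (ce i X Y t u).2).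

Lemma cf_comp m n p i (X : tc m) (Y : tc n) : cf (tcomp p i X Y) = cf X * cf Y.
Proof. by []. Qed.

Section Zones.
Variables (m n p : nat) (e : (m + n = p.+1)%N) (i : nat) (im : (i < m)%N).
Variables (X : tc m) (Y : tc n).

Lemma zones t : (t < p)%N -> (exists2 r, (r < n)%N & t = (i + r)%N) \/
  (exists j, [/\ (j < m)%N, j != i & t = outer_pos i n j]).
Proof.
move=> tp; have := block_pos e (Ordinal im) (Ordinal tp).
case=> [[r tE]|[j ji tE]]; [left; exists r => //|right; exists j; split=> //].
Qed.

Lemma in_lt r : (r < n)%N -> (i + r < p)%N.
Proof. lia. Qed.

Lemma out_lt j : (j < m)%N -> j != i -> (outer_pos i n j < p)%N.
Proof. by rewrite /outer_pos; case: ifP; lia. Qed.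

Lemma av_in r : (r < n)%N -> av (tcomp p i X Y) (i + r) = av X i * av Y r.
Proof.
move=> rn; rewrite av_mk ?in_lt ?aug_ca // /ca in_block_in //.
by rewrite addKn.
Qed.

Lemma av_out j : (j < m)%N -> j != i ->
  av (tcomp p i X Y) (outer_pos i n j) = cf Y *: av X j.
Proof.
move=> jm ji; rewrite av_mk ?out_lt ?aug_ca // /ca in_block_out //.
by rewrite outer_idxK.
Qed.

Lemma ev_ce t u : (t < p)%N -> (u < p)%N -> t != u ->
  ev (tcomp p i X Y) t u = ce i X Y t u.
Proof.
move=> tp up tu; rewrite /ev !av_mk ?aug_ca // mv_mk //.
  by rewrite -ce1; case: (ce _ _ _ _ _).
by rewrite -esw_ce.
Qed.

Lemma outer_pos_inj j j' : j != i -> j' != i ->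
  outer_pos i n j = outer_pos i n j' -> j = j'.
Proof. by move=> ji ji' jj; rewrite -(@outer_idxK n i j) // jj outer_idxK. Qed.

Lemma in_neq_out r j : (r < n)%N -> j != i -> (i + r)%N != outer_pos i n j.
Proof.
move=> rn ji; have := in_block_out n ji; apply: contraFneq => <-.
exact: in_block_in.
Qed.

Lemma ev_in_in r s : (r < n)%N -> (s < n)%N -> r != s ->
  ev (tcomp p i X Y) (i + r) (i + s) = lact (av X i) (ev Y r s).
Proof.
move=> rn sn rs; rewrite ev_ce ?in_lt ?eqn_add2l // /ce !in_block_in //.
by rewrite !addKn.
Qed.

Lemma ev_in_out r j : (r < n)%N -> (j < m)%N -> j != i ->
  ev (tcomp p i X Y) (i + r) (outer_pos i n j) = ract1 (ev X i j) (av Y r).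
Proof.
move=> rn jm ji; rewrite ev_ce ?in_lt ?out_lt ?in_neq_out //.
by rewrite /ce in_block_in // in_block_out // outer_idxK // addKn.
Qed.

Lemma ev_out_in r j : (r < n)%N -> (j < m)%N -> j != i ->
  ev (tcomp p i X Y) (outer_pos i n j) (i + r) = ract2 (ev X j i) (av Y r).
Proof. by move=> rn jm ji; rewrite -esw_ev ev_in_out // esw_ract1 esw_ev. Qed.

Lemma ev_out_out j j' : (j < m)%N -> j != i -> (j' < m)%N -> j' != i ->
  j != j' ->
  ev (tcomp p i X Y) (outer_pos i n j) (outer_pos i n j') = escale (cf Y) (ev X j j').
Proof.
move=> jm ji j'm j'i jj'; rewrite ev_ce ?out_lt //; last first.
  by apply: contra_neq jj'; apply: outer_pos_inj.
by rewrite /ce !in_block_out // !outer_idxK.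
Qed.

End Zones.

(** Comparing at all pairs [t != u], and not only at increasing ones, frees the case analysis by
    zones from the order of the inputs. *)
Lemma tcarrier_eq_ev n (X Y : tc n) : cf X = cf Y ->
  (forall t, (t < n)%N -> av X t = av Y t) ->
  (forall t u, (t < n)%N -> (u < n)%N -> t != u -> ev X t u = ev Y t u) -> X = Y.
Proof.
move=> cE aE eE; apply: tcarrier_eq => // t u tu un.
by have [] : ev X t u = ev Y t u by apply: eE => //; lia.
Qed.

Lemma tcomp_linl m n p (e : (m + n = p.+1)%N) (i : 'I_m) (Y : tc n) :
  linear (fun X : tc m => tcomp p i X Y).
Proof.
have im := ltn_ord i; move=> c X X'; apply: tcarrier_eq.
- by rewrite cf_lin !cf_comp cf_lin; ring.
- move=> t /(zones e im)[[r rn ->]|[j [jm ji ->]]]; rewrite av_lin.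
    by rewrite !(av_in e) // av_lin mulrDl scalerAl.
  by rewrite !(av_out e) // av_lin scalerDr !scalerA mulrC.
- move=> t u tu up; have tp := ltn_trans tu up; rewrite mv_lin.
  have {tu} tu : t != u by lia.
  rewrite -3![mv (tcomp _ _ _ _) _ _]/((ev _ t u).2).
  case: (zones e im tp) tu => [[r rn ->]|[j [jm ji ->]]];
    case: (zones e im up) => [[s sn ->]|[h [hm hi ->]]] tu;
    rewrite ?(ev_in_in e, ev_in_out e, ev_out_in e, ev_out_out e) //=;
    try (by [lia | apply: contraNneq tu => ->]);
    rewrite ?aug_av ?(av_lin, mv_lin, cf_lin) ?mlin;
    apply: eq_by_functionals => phi pD pN pZ; rewrite !(pD, pN, pZ); ring.
Qed.

Lemma tcomp_linr m n p (e : (m + n = p.+1)%N) (i : 'I_m) (X : tc m) :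
  linear (fun Y : tc n => tcomp p i X Y).
Proof.
have im := ltn_ord i; move=> c Y Y'; apply: tcarrier_eq.
- by rewrite cf_lin !cf_comp cf_lin; ring.
- move=> t /(zones e im)[[r rn ->]|[j [jm ji ->]]]; rewrite av_lin.
    by rewrite !(av_in e) // av_lin mulrDr scalerAr.
  by rewrite !(av_out e) // cf_lin scalerDl scalerA.
- move=> t u tu up; have tp := ltn_trans tu up; rewrite mv_lin.
  have {tu} tu : t != u by lia.
  rewrite -3![mv (tcomp _ _ _ _) _ _]/((ev _ t u).2).
  case: (zones e im tp) tu => [[r rn ->]|[j [jm ji ->]]];
    case: (zones e im up) => [[s sn ->]|[h [hm hi ->]]] tu;
    rewrite ?(ev_in_in e, ev_in_out e, ev_out_in e, ev_out_out e) //=;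
    try (by [lia | apply: contraNneq tu => ->]);
    rewrite ?aug_av ?(av_lin, mv_lin, cf_lin) ?mlin;
    apply: eq_by_functionals => phi pD pN pZ; rewrite !(pD, pN, pZ); ring.
Qed.

End TridentOperad.

(** * The operad axioms *)

Section TridentOperadAxioms.
Variables (k : fieldType) (T : trident k).
Local Notation A := (td_alg T).
Local Notation M := (td_mod T).
Local Notation tc := (tcarrier T).

Definition tone n : tc n := tmk n 1 (fun=> 1) (fun _ _ => 0).

Lemma cf_one n : cf (tone n) = 1. Proof. by []. Qed.

Lemma av_one n t : (t < n)%N -> av (tone n) t = 1.
Proof. by move=> tn; rewrite av_mk // aug1. Qed.

Lemma ev_one n t u : (t < n)%N -> (u < n)%N -> t != u ->
  ev (tone n) t u = (1, 1, 0).
Proof. by move=> tn un tu; rewrite /ev !av_one // mv_mk // mlin. Qed.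

Lemma tcomp_one n (e : (n + 1 = n.+1)%N) (i : 'I_n) (X : tc n) :
  tcomp n i X (tone 1) = X.
Proof.
have im := ltn_ord i.
have inE r : (r < 1)%N -> (i + r)%N = i by lia.
have outE (j : nat) : j != i -> outer_pos i 1 j = j.
  by rewrite /outer_pos; case: ifP; lia.
apply: tcarrier_eq_ev; first by rewrite cf_comp cf_one mulr1.
- move=> t /(zones e im)[[r rn ->]|[j [jm ji ->]]].
    by rewrite (av_in e) // av_one // mulr1 inE.
  by rewrite (av_out e) // cf_one scale1r outE.
- move=> t u /(zones e im)[[r rn ->]|[j [jm ji ->]]];
    move=> /(zones e im)[[s sn ->]|[h [hm hi ->]]] tu.
  + by lia.
  + by rewrite (ev_in_out e) // av_one // ract1_1 inE // outE.
  + by rewrite (ev_out_in e) // av_one // ract2_1 inE // outE.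
  + rewrite (ev_out_out e) //; last by apply: contraNneq tu => ->.
    rewrite cf_one !outE //.
    by apply: elt_eq; rewrite /= scale1r.
Qed.

Lemma one_tcomp n (e : (1 + n = n.+1)%N) (i : 'I_1) (X : tc n) :
  tcomp n i (tone 1) X = X.
Proof.
have im := ltn_ord i.
have i0 : i = 0%N :> nat by lia.
apply: tcarrier_eq_ev; first by rewrite cf_comp cf_one mul1r.
- move=> t /(zones e im)[[r rn ->]|[j [jm ji ->]]]; last lia.
  by rewrite (av_in e) // av_one // mul1r i0.
- move=> t u /(zones e im)[[r rn ->]|[j [jm ji ->]]]; last lia.
  move=> /(zones e im)[[s sn ->]|[h [hm hi ->]]]; last lia.
  by rewrite eqn_add2l => rs; rewrite (ev_in_in e) // av_one // lact1 i0.
Qed.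

Lemma tcomp_com m n p (e : (m + n = p.+1)%N) (i : 'I_m) :
  tcomp p i (tone m) (tone n) = tone p.
Proof.
have im := ltn_ord i.
apply: tcarrier_eq_ev; first by rewrite cf_comp !cf_one mulr1.
- move=> t tp; rewrite av_one //.
  case/(zones e im): tp => [[r rn ->]|[j [jm ji ->]]].
    by rewrite (av_in e) // !av_one // mulr1.
  by rewrite (av_out e) // cf_one av_one // scale1r.
- move=> t u tp up tu; rewrite ev_one //.
  case: (zones e im tp) tu => [[r rn ->]|[j [jm ji ->]]];
    case: (zones e im up) => [[s sn ->]|[h [hm hi ->]]] tu.
  + rewrite eqn_add2l in tu.
    by rewrite (ev_in_in e) // av_one // lact1 ev_one.
  + by rewrite (ev_in_out e) // av_one // ract1_1 ev_one // eq_sym.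
  + by rewrite (ev_out_in e) // av_one // ract2_1 ev_one.
  + have jh : j != h by apply: contraNneq tu => ->.
    rewrite (ev_out_out e) // cf_one ev_one //.
    by apply: elt_eq; rewrite /= ?scale1r.
Qed.

(** The zones [z1], [z2], [z3] give the position of an input for both bracketings. Two inputs of [Z]
    lead to [lactM], inputs of [Z] and [Y] to the commutation of left and right actions, inputs of
    [Z] and [X] to [ract1M] or [ract2M], and the other pairs to scalar rules. *)
Lemma tcomp_seq l m n lm mn lmn
    (e1 : (l + m = lm.+1)%N) (e2 : (lm + n = lmn.+1)%N)
    (e3 : (m + n = mn.+1)%N) (e4 : (l + mn = lmn.+1)%N)
    (i : 'I_l) (j : 'I_m) (ij : 'I_lm) (X : tc l) (Y : tc m) (Z : tc n) :
  ij = (i + j)%N :> nat ->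
  tcomp lmn ij (tcomp lm i X Y) Z = tcomp lmn i X (tcomp mn j Y Z).
Proof.
move=> ijE; have il := ltn_ord i; have jm := ltn_ord j.
have ijl : (i + j < lm)%N by rewrite -ijE.
rewrite ijE.
(* z1, z2, z3: the input t of the composite comes from Z, from Y, from X. *)
pose z1 t := exists r, [/\ (r < n)%N, t = (i + j + r)%N & t = (i + (j + r))%N].
pose z2 t := exists q, [/\ (q < m)%N, q != j, (i + q < lm)%N & (i + q != i + j)%N]
  /\ [/\ (outer_pos j n q < mn)%N, t = outer_pos (i + j) n (i + q) &
         t = (i + outer_pos j n q)%N].
pose z3 t := exists h,
  [/\ (h < l)%N, h != i, (outer_pos i m h < lm)%N & outer_pos i m h != (i + j)%N]
  /\ t = outer_pos (i + j) n (outer_pos i m h) /\ t = outer_pos i mn h.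
have zone t : (t < lmn)%N -> [\/ z1 t, z2 t | z3 t].
  move=> /(zones e4 il)[[v vmn ->]|[h [hl hi ->]]].
    case/(zones e3 jm): vmn => [[r rn ->]|[q [qm qj ->]]].
      by constructor 1; exists r; split=> //; lia.
    constructor 2; exists q; split; split=> //; try lia.
      exact: (out_lt e3).
    by rewrite /outer_pos; case: ifP; case: ifP; lia.
  constructor 3; exists h; split.
    by split=> //; [exact: (out_lt e1)|rewrite eq_sym in_neq_out].
  by split=> //; rewrite /outer_pos; (do !case: ifP); lia.
apply: tcarrier_eq_ev; first by rewrite !cf_comp mulrA.
- move=> t /zone[[r [rn tE1 tE2]]|[q [[qm qj qlm qij] [omn tE1 tE2]]]
    |[h [[hl hi olm oij] [tE1 tE2]]]]; rewrite [t in LHS]tE1 [t in RHS]tE2.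
  + by rewrite (av_in e2) // (av_in e1) // (av_in e4) ?(av_in e3) ?mulrA //; lia.
  + by rewrite (av_out e2) // (av_in e1) // (av_in e4) // (av_out e3) // scalerAr.
  + by rewrite (av_out e2) // (av_out e1) // (av_out e4) // scalerA mulrC.
- have wf := @ev_wf k T.
  move=> t u /zone[[r [rn tE1 tE2]]|[q [[qm qj qlm qij] [omn tE1 tE2]]]
    |[h [[hl hi olm oij] [tE1 tE2]]]];
  move=> /zone[[r' [rn' uE1 uE2]]|[q' [[qm' qj' qlm' qij'] [omn' uE1 uE2]]]
    |[h' [[hl' hi' olm' oij'] [uE1 uE2]]]] tu;
  rewrite [t in LHS]tE1 [t in RHS]tE2 [u in LHS]uE1 [u in RHS]uE2.
  + rewrite (ev_in_in e2) ?(ev_in_in e4) ?(ev_in_in e3) ?(av_in e1) //; try lia.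
    by rewrite lactM.
  + rewrite (ev_in_out e2) // (ev_in_in e1) ?(ev_in_in e4) ?(ev_in_out e3) //; try lia.
    by rewrite lact_ract1.
  + rewrite (ev_in_out e2) // (ev_in_out e1) ?(ev_in_out e4) ?(av_in e3) //; try lia.
    by rewrite ract1M.
  + rewrite (ev_out_in e2) // (ev_in_in e1) ?(ev_in_in e4) ?(ev_out_in e3) //; try lia.
    by rewrite lact_ract2.
  + have qq : q != q' by apply: contraNneq tu => qq; rewrite tE1 uE1 qq.
    rewrite (ev_out_out e2) ?(ev_in_in e1) ?(ev_in_in e4) ?(ev_out_out e3) //; try lia.
    by rewrite lact_scale.
  + rewrite (ev_out_out e2) ?(ev_in_out e1) ?(ev_in_out e4) ?(av_out e3) //; try lia.
      by rewrite ract1_scalar.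
    by apply: contraNneq tu => qq; rewrite tE1 uE1 qq.
  + rewrite (ev_out_in e2) // (ev_out_in e1) ?(ev_out_in e4) ?(av_in e3) //; try lia.
    by rewrite ract2M.
  + rewrite (ev_out_out e2) ?(ev_out_in e1) ?(ev_out_in e4) ?(av_out e3) //; try lia.
      by rewrite ract2_scalar.
    by apply: contraNneq tu => qq; rewrite tE1 uE1 qq.
  + have hh : h != h' by apply: contraNneq tu => qq; rewrite tE1 uE1 qq.
    rewrite (ev_out_out e2) ?(ev_out_out e1) ?(ev_out_out e4) //.
      by rewrite escaleM cf_comp mulrC.
    by apply: contraNneq tu => qq; rewrite tE1 uE1 qq.
Qed.

Local Ltac side := by [| lia | exact: in_neq_out | rewrite eq_sym in_neq_out
  | match goal with H : is_true (_ != _) |- _ => apply: contraNneq H => -> end].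

(** The essential case is one input of [Y] and one of [Z], where [ract12] says that the right
    actions at the two inputs of an operation commute. *)
Lemma tcomp_par l m n lm ln lmn
    (e1 : (l + m = lm.+1)%N) (e2 : (lm + n = lmn.+1)%N)
    (e3 : (l + n = ln.+1)%N) (e4 : (ln + m = lmn.+1)%N)
    (i j : 'I_l) (j' : 'I_lm) (i' : 'I_ln) (X : tc l) (Y : tc m) (Z : tc n) :
  (i < j)%N -> j'.+1 = (j + m)%N :> nat -> i' = i :> nat ->
  tcomp lmn j' (tcomp lm i X Y) Z = tcomp lmn i' (tcomp ln j X Z) Y.
Proof.
move=> ltij j'E i'E; have il := ltn_ord i; have jl := ltn_ord j.
(* [j'] and [i'] are the places of [j] and [i] after the other one has been replaced, so the rules
   for outer inputs apply to them. *)
have j'P : j' = outer_pos i m j :> nat by rewrite /outer_pos; case: ifP; lia.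
have i'P : i' = outer_pos j n i :> nat by rewrite /outer_pos; case: ifP; lia.
have j'lm := ltn_ord j'; have i'ln := ltn_ord i'.
have ji : (j : nat) != i by lia.
have ij : (i : nat) != j by lia.
(* z1, z2, z3: the input t of the composite comes from Y, from Z, from X. *)
pose z1 t := exists r, [/\ (r < m)%N, (i + r < lm)%N & (i + r)%N != j']
  /\ t = outer_pos j' n (i + r) /\ t = (i' + r)%N.
pose z2 t := exists r, [/\ (r < n)%N, (j + r < ln)%N & (j + r)%N != i']
  /\ t = (j' + r)%N /\ t = outer_pos i' m (j + r).
pose z3 t := exists h, [/\ (h < l)%N, h != i & h != j] /\
  [/\ (outer_pos i m h < lm)%N, outer_pos i m h != j',
      (outer_pos j n h < ln)%N & outer_pos j n h != i'] /\
  (t = outer_pos j' n (outer_pos i m h) /\ t = outer_pos i' m (outer_pos j n h)).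
have zone t : (t < lmn)%N -> [\/ z1 t, z2 t | z3 t].
  move=> /(zones e2 j'lm)[[r rn ->]|[v [vlm vj' ->]]].
    by constructor 2; exists r; rewrite /outer_pos; (do !split) => //; try lia;
      case: ifP; lia.
  case/(zones e1 il): vlm vj' => [[r rm ->]|[h [hl hi ->]]] vj'.
    by constructor 1; exists r; rewrite /outer_pos; (do !split) => //; try lia;
      case: ifP; lia.
  have hj : h != j by apply: contraNneq vj' => ->; rewrite j'P.
  constructor 3; exists h; split=> //; split; last first.
    by split=> //; rewrite /outer_pos; (do !case: ifP); lia.
  split=> //; [exact: (out_lt e1)|exact: (out_lt e3)|].
  by rewrite i'P; apply: contraNneq hi => /(outer_pos_inj hj ij) ->.
apply: tcarrier_eq_ev; first by rewrite !cf_comp mulrAC.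
- move=> t /zone[[r [[rm rlm rj'] [tE1 tE2]]]|[r [[rn rln ri'] [tE1 tE2]]]
    |[h [[hl hi hj] [[olm oj' oln oi'] [tE1 tE2]]]]];
    rewrite [t in LHS]tE1 [t in RHS]tE2.
  + rewrite (av_out e2) // (av_in e1) // (av_in e4) // i'P (av_out e3) //.
    by rewrite scalerAl.
  + rewrite (av_in e2) // (av_out e4) // (av_in e3) // j'P (av_out e1) //.
    by rewrite scalerAl.
  + by rewrite (av_out e2) // (av_out e1) // (av_out e4) // (av_out e3) //
      !scalerA mulrC.
- have wf := @ev_wf k T.
  move=> t u /zone[[r [[rm rlm rj'] [tE1 tE2]]]|[r [[rn rln ri'] [tE1 tE2]]]
    |[h [[hl hi hj] [[olm oj' oln oi'] [tE1 tE2]]]]];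
  move=> /zone[[r' [[rm' rlm' rj''] [uE1 uE2]]]|[r' [[rn' rln' ri''] [uE1 uE2]]]
    |[h' [[hl' hi' hj'] [[olm' oj'' oln' oi''] [uE1 uE2]]]]] tu;
  rewrite [t in LHS]tE1 [t in RHS]tE2 [u in LHS]uE1 [u in RHS]uE2;
  (have tu1 := tu; rewrite tE1 uE1 in tu1);
  (have tu2 := tu; rewrite tE2 uE2 in tu2).
  + rewrite (ev_out_out e2) ?(ev_in_in e1) ?(ev_in_in e4) //; try side.
    by rewrite i'P (av_out e3) // lact_scalar.
  + rewrite (ev_out_in e2) ?(ev_in_out e4) //; try side.
    by rewrite j'P i'P (ev_in_out e1) // (ev_out_in e3) // ract12.
  + rewrite (ev_out_out e2) ?(ev_in_out e1) ?(ev_in_out e4) //; try side.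
    by rewrite i'P (ev_out_out e3) ?ract1_scale //; side.
  + rewrite (ev_in_out e2) ?(ev_out_in e4) //; try side.
    by rewrite j'P i'P (ev_out_in e1) // (ev_in_out e3) // ract12.
  + rewrite (ev_in_in e2) ?(ev_out_out e4) ?(ev_in_in e3) //; try side.
    by rewrite j'P (av_out e1) // lact_scalar.
  + rewrite (ev_in_out e2) ?(ev_out_out e4) ?(ev_in_out e3) //; try side.
    by rewrite j'P (ev_out_out e1) ?ract1_scale //; side.
  + rewrite (ev_out_out e2) ?(ev_out_in e1) ?(ev_out_in e4) //; try side.
    by rewrite i'P (ev_out_out e3) ?ract2_scale //; side.
  + rewrite (ev_out_in e2) ?(ev_out_out e4) ?(ev_out_in e3) //; try side.
    by rewrite j'P (ev_out_out e1) ?ract2_scale //; side.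
  + have hh : h != h' by apply: contraNneq tu1 => ->.
    rewrite (ev_out_out e2) ?(ev_out_out e4) //; try side.
    by rewrite (ev_out_out e1) // (ev_out_out e3) // !escaleM mulrC.
Qed.

Definition sn n (s : 'S_n) (t : nat) : nat :=
  if insub t is Some i then s i else t.

Lemma sn_ord n (s : 'S_n) (t : 'I_n) : sn s t = s t.
Proof. by rewrite /sn valK. Qed.

Definition tact n (X : tc n) (s : 'S_n) : tc n :=
  tmk n (cf X) (fun t => av X (sn s t)) (fun t u => mv X (sn s t) (sn s u)).

Lemma av_act n (X : tc n) s (t : 'I_n) : av (tact X s) t = av X (s t).
Proof. by rewrite av_mk ?aug_av // sn_ord. Qed.

Lemma ev_act n (X : tc n) s (t u : 'I_n) : t != u ->
  ev (tact X s) t u = ev X (s t) (s u).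
Proof.
move=> tu; rewrite /ev !av_act mv_mk ?sn_ord //.
by have := esw_ev X (s t) (s u) => -[].
Qed.

Lemma tcarrier_eq_ord n (X Y : tc n) : cf X = cf Y ->
  (forall t : 'I_n, av X t = av Y t) ->
  (forall t u : 'I_n, t != u -> ev X t u = ev Y t u) -> X = Y.
Proof.
move=> cE aE eE; apply: tcarrier_eq_ev => // [t tn|t u tn un tu].
  exact: (aE (Ordinal tn)).
exact: (eE (Ordinal tn) (Ordinal un)).
Qed.

Lemma tactP n : right_perm_action (@tact n).
Proof.
split=> [s c X Y|X|X s s'].
- apply: tcarrier_eq => [//|t tn|t u tu un].
    by rewrite -[t]/(val (Ordinal tn)) av_lin !av_act av_lin.
  have tn := ltn_trans tu un; rewrite mv_lin.
  have tu' : Ordinal tn != Ordinal un by rewrite -val_eqE /=; lia.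
  by rewrite -3![mv _ t u]/((ev _ (Ordinal tn) (Ordinal un)).2) !ev_act //= mv_lin.
- apply: tcarrier_eq_ord => [//|t|t u tu]; first by rewrite av_act perm1.
  by rewrite ev_act // !perm1.
- apply: tcarrier_eq_ord => [//|t|t u tu]; first by rewrite !av_act permM.
  by rewrite !ev_act ?(inj_eq perm_inj) // !permM.
Qed.

Lemma tone_act n s : tact (tone n) s = tone n.
Proof.
apply: tcarrier_eq_ord => [//|t|t u tu]; first by rewrite av_act !av_one.
by rewrite ev_act // !ev_one // val_eqE (inj_eq perm_inj).
Qed.

Lemma tcomp_act m n p (e : (m + n = p.+1)%N) (i : 'I_m)
    (phi : 'S_m) (sigma : 'S_n) (s : 'S_p) (X : tc m) (Y : tc n) :
  block_perm i phi sigma s ->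
  tcomp p i (tact X phi) (tact Y sigma) = tact (tcomp p (phi i) X Y) s.
Proof.
move=> [s_in s_out]; have im := ltn_ord i; have pim := ltn_ord (phi i).
have pne (j j' : 'I_m) : j != j' -> (phi j : nat) != phi j'.
  by move=> jj; rewrite val_eqE (inj_eq perm_inj).
apply: tcarrier_eq_ord => [//|t|t u tu].
- rewrite av_act; case: (block_pos e i t) => [[r tE]|[j ji tE]].
    by rewrite (s_in r) // tE (av_in e) // (av_in e) // !av_act.
  by rewrite (s_out j) // tE (av_out e) // (av_out e) ?pne // av_act.
- have tu' : (t : nat) != u by [].
  rewrite ev_act //; move: tu'.
  case: (block_pos e i t) => [[r tE]|[j ji tE]];
    case: (block_pos e i u) => [[r' uE]|[j' ji' uE]];
    [rewrite (s_in r t) // (s_in r' u) //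
    |rewrite (s_in r t) // (s_out j' u) //
    |rewrite (s_out j t) // (s_in r' u) //
    |rewrite (s_out j t) // (s_out j' u) //]; rewrite tE uE => tu'.
  + have rr : r != r' by apply: contraNneq tu' => ->.
    by rewrite !(ev_in_in e) ?val_eqE ?(inj_eq perm_inj) // av_act ev_act.
  + by rewrite !(ev_in_out e) ?pne // ev_act 1?eq_sym // av_act.
  + by rewrite !(ev_out_in e) ?pne // ev_act // av_act.
  + have jj : j != j' by apply: contraNneq tu' => ->.
    by rewrite !(ev_out_out e) ?pne // ev_act.
Qed.

End TridentOperadAxioms.

(** * Augmentation, faces and dimension *)

Section TridentComaug.
Variables (k : fieldType) (T : trident k).
Local Notation M := (td_mod T).
Local Notation tc := (tcarrier T).

Definition trident_operad : operad k :=
  @Operad k tc (@tact k T) (tone T 1)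
    (fun m n p _ i X Y => tcomp p i X Y) (@tactP k T)
    (fun m n p e i Y => tcomp_linl e i Y) (fun m n p e i X => tcomp_linr e i X)
    (@tcomp_one k T) (@one_tcomp k T) (@tcomp_seq k T) (@tcomp_par k T)
    (@tcomp_act k T).

Lemma tc0_scalar (X : tc 0) : X = cf X *: tone T 0.
Proof.
apply: tcarrier_eq => //.
by rewrite -[cf X *: _]addr0 cf_lin cf_one mulr1 addr0.
Qed.

Lemma tone_neq0 n : tone T n != 0.
Proof. by apply: contra_neq (oner_neq0 k) => /(congr1 (@cf k T n)). Qed.

Lemma tone_basis : basis_of {: trident_operad 0%N} [:: tone T 0].
Proof.
apply/andP; split; last by rewrite seq1_free tone_neq0.
rewrite span_seq1 eqEsubv subvf /=; apply/subvP => X _.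
by apply/vlineP; exists (cf X); apply: tc0_scalar.
Qed.

Definition trident_unitary : unitary_operad k :=
  @UnitaryOperad k trident_operad (tone T 0) tone_basis.

Definition tscale n (c : k^o) : tc n := c *: tone T n.

Lemma tscale_linear n : linear (@tscale n).
Proof. by move=> c x y; rewrite /tscale scalerDl scalerA. Qed.
HB.instance Definition _ n :=
  GRing.isLinear.Build k k^o (tc n) *:%R (@tscale n) (@tscale_linear n).

Lemma tscale_act n (c : Com k n) (s : 'S_n) :
  linfun (@tscale n) (op_act c s) = op_act (linfun (@tscale n) c : trident_operad n) s.
Proof.
rewrite !lfunE; apply/esym/(etrans (op_actZ (P := trident_operad) s c (tone T n))).
by congr (_ *: _); apply: tone_act.
Qed.

Lemma tscale_one : linfun (@tscale 1) (op_one (Com k)) = op_one trident_operad.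
Proof. by rewrite lfunE /= /tscale scale1r. Qed.

Lemma tscale_comp m n p (e : (m + n = p.+1)%N) (i : 'I_m)
    (c : Com k m) (d : Com k n) :
  linfun (@tscale p) (op_comp e i c d) =
  op_comp e i (linfun (@tscale m) c : trident_operad m) (linfun (@tscale n) d).
Proof.
have -> : linfun (@tscale p) (op_comp e i c d) = c *: (d *: tone T p).
  by rewrite lfunE scalerA.
rewrite !lfunE -(tcomp_com T e i); apply/esym.
transitivity (c *: @op_comp k trident_operad m n p e i (tone T m) (tscale n d)).
  exact: (@op_compZl _ trident_operad _ _ _ e i (tscale n d) c (tone T m)).
congr (_ *: _).
exact: (@op_compZr _ trident_operad _ _ _ e i (tone T m) d (tone T n)).
Qed.

Definition trident_aug : operad_hom (Com k) trident_unitary :=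
  @OperadHom k (Com k) trident_operad (fun n => linfun (@tscale n))
    tscale_act tscale_one tscale_comp.

Lemma trident_aug_unit :
  trident_aug 0%N (uo_unit (Com k)) = uo_unit trident_unitary.
Proof. by rewrite /= lfunE /= /tscale scale1r. Qed.

Definition trident_comaug : comaug_operad k :=
  ComaugOperad trident_aug_unit.

Lemma com_elt_trident n : com_elt trident_comaug n = tone T n.
Proof. by rewrite /com_elt /= lfunE /= /tscale scale1r. Qed.

Section TridentFaces.
Variables (n i : nat) (X : tc n.+1).
Hypothesis i_n : (i <= n)%N.
Local Notation fX := (@face k trident_comaug n i X).

Lemma trident_faceE : fX = tcomp n i X (tone T 0).
Proof. by rewrite /face com_elt_trident /= inordK. Qed.

Lemma cf_face : cf fX = cf X.
Proof. by rewrite trident_faceE cf_comp cf_one mulr1. Qed.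

Lemma av_face j : (j <= n)%N -> j != i -> av fX (outer_pos i 0 j) = av X j.
Proof.
by move=> jn ji; rewrite trident_faceE (av_out (addn0 n.+1)) // cf_one scale1r.
Qed.

Lemma ev_face j j' : (j <= n)%N -> j != i -> (j' <= n)%N -> j' != i -> j != j' ->
  ev fX (outer_pos i 0 j) (outer_pos i 0 j') = ev X j j'.
Proof.
move=> jn ji jn' ji' jj; rewrite trident_faceE (ev_out_out (addn0 n.+1)) // cf_one.
by apply: elt_eq; rewrite /= scale1r.
Qed.

End TridentFaces.

Lemma av0 n t : av (0 : tc n) t = 0.
Proof. by apply: (linE (h := fun X : tc n => av X t) _).2 => c X Y; apply: av_lin. Qed.

Lemma mv0 n t u : mv (0 : tc n) t u = 0.
Proof. by apply: (linE (h := fun X : tc n => mv X t u) _).2 => c X Y; apply: mv_lin. Qed.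

(** In arity at least 3 every pair of inputs survives some face, which removes a third input, and
    the restrictions to one and two inputs determine an operation. *)
Lemma trident_coskeletal : coskeletal 2 trident_comaug.
Proof.
move=> n X n2 X0; apply: (tcarrier_eq (Y := 0)).
- by rewrite -(cf_face X (leq0n n)) X0.
- move=> t tn; have [i [i_n ti]] : exists i, (i <= n)%N /\ t != i.
    by case: t {tn} => [|t]; [exists 1%N|exists 0%N]; split=> //; lia.
  by rewrite -(av_face X i_n) // X0 // !av0.
- move=> t u tu un.
  have [i [i_n ti ui]] : exists i, [/\ (i <= n)%N, t != i & u != i].
    case: t tu => [|t] tu; last by exists 0%N; split=> //; lia.
    case: u un tu => [|[|u]] // un tu; [exists 2%N|exists 1%N]; split=> //; lia.
  rewrite -[LHS]/((ev X t u).2) -(ev_face X i_n) //; try lia.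
  by rewrite X0 //= !mv0.
Qed.

Definition tmod (mu : M) : tc 2 :=
  tmk 2 0 (fun=> 0) (fun t u => if (t < u)%N then mu else sw mu).

Lemma av_tmod mu t : (t < 2)%N -> av (tmod mu) t = 0.
Proof. by move=> t2; rewrite av_mk // /aug linear0. Qed.

Lemma mv_tmod mu : mv (tmod mu) 0 1 = mu.
Proof. by rewrite mv_mk. Qed.

Lemma face_tmod i mu : (i <= 1)%N -> @face k trident_comaug 1 i (tmod mu) = 0.
Proof.
move=> i1; apply: (tcarrier_eq (Y := 0)) => [|t t1|t u tu un]; last lia.
  by rewrite cf_face.
have [j [j1 ji ->]] : exists j, [/\ (j <= 1)%N, j != i & t = outer_pos i 0 j].
  by exists (1 - i)%N; rewrite /outer_pos; split; try case: ifP; lia.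
by rewrite av_face // av_tmod // av0.
Qed.

Lemma GKdim_trident (R : realType) : GKdim R trident_comaug = 3%:E.
Proof.
have : vpick {: M}%VS != 0 by rewrite vpick0 td_mod_neq0.
set mu := vpick _ => mu0.
apply: (@GKdim3 k trident_comaug R (tmod mu) trident_coskeletal);
  rewrite ?face_tmod //.
apply: contra_neq mu0 => mu0.
by rewrite -(mv_tmod mu) mu0 mv0.
Qed.

Definition trident_operad3 (R : realType) : comaug_operad3 R k :=
  ComaugOperad3 (GKdim_trident R).

End TridentComaug.

(** * The trident algebra of an operad *)

Section UnaryAlgebra.
Variables (k : fieldType) (P : comaug_operad k).

Definition unary_alg : Type := P 1%N.
HB.instance Definition _ := Vector.on unary_alg.
Implicit Types x y z : unary_alg.

Definition umul x y : unary_alg := op_comp (erefl 2%N : (1 + 1 = 2)%N) ord0 x y.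

Lemma umulA : associative umul.
Proof. by move=> x y z; apply/esym/op_comp_seq. Qed.

Lemma umul1 : left_id (com_elt P 1 : unary_alg) umul.
Proof. by move=> x; apply: op_1comp. Qed.

Lemma umulr1 : right_id (com_elt P 1 : unary_alg) umul.
Proof. by move=> x; apply: op_comp1. Qed.

Lemma umulDl : left_distributive umul +%R.
Proof. by move=> x y z; apply: op_compDl. Qed.

Lemma umulDr : right_distributive umul +%R.
Proof. by move=> x y z; apply: op_compDr. Qed.

Lemma uone_neq0 : (com_elt P 1 : unary_alg) != 0.
Proof.
apply: contra_neq (com_elt0_neq0 P) => /(congr1 (@face k P 0 0)).
by rewrite face_com linear0.
Qed.

HB.instance Definition _ := GRing.Zmodule_isNzRing.Build unary_alg
  umulA umul1 umulr1 umulDl umulDr uone_neq0.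

Lemma uscaleAl (c : k) x y : c *: (x * y) = c *: x * y.
Proof. by apply/esym; apply: op_compZl. Qed.
HB.instance Definition _ := GRing.Lmodule_isLalgebra.Build k unary_alg uscaleAl.

Lemma uscaleAr (c : k) x y : c *: (x * y) = x * (c *: y).
Proof. by apply/esym; apply: op_compZr. Qed.
HB.instance Definition _ := GRing.Lalgebra_isAlgebra.Build k unary_alg uscaleAr.
HB.instance Definition _ := Algebra_isFalgebra.Build k unary_alg.

Definition ualg : falgType k := unary_alg.

Definition val0 (x : P 0%N) : k := sval (cid (arity0_gen x)).

Lemma val0E (x : P 0%N) : x = val0 x *: com_elt P 0.
Proof. exact: svalP (cid (arity0_gen x)). Qed.

Lemma val0_scale c : val0 (c *: com_elt P 0) = c.
Proof.
have /eqP := val0E (c *: com_elt P 0).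
rewrite -subr_eq0 -scalerBl scaler_eq0 (negbTE (com_elt0_neq0 P)) orbF subr_eq0.
by move=> /eqP <-.
Qed.

Definition ueps (x : ualg) : k^o := val0 (face 0 (x : P 1%N)).

Lemma face0_ueps (x : ualg) : face 0 (x : P 1%N) = ueps x *: com_elt P 0.
Proof. exact: val0E. Qed.

Lemma ueps_linear : linear ueps.
Proof.
move=> c x y; rewrite /ueps linearP /= [in LHS](val0E (face 0 (x : P 1%N))).
by rewrite [in LHS](val0E (face 0 (y : P 1%N))) scalerA -scalerDl val0_scale.
Qed.
HB.instance Definition _ := GRing.isLinear.Build k ualg k^o *:%R ueps ueps_linear.

(** [face 0 (x * y)] is x o (y o 1_0), and y o 1_0 is the multiple [ueps y] of 1_0. *)
Lemma ueps_monoid : monoid_morphism ueps.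
Proof.
split=> [|x y]; first by rewrite /ueps face_com -[com_elt P 0]scale1r val0_scale.
rewrite /ueps [X in val0 X](_ : _ = (ueps x * ueps y : k) *: com_elt P 0) ?val0_scale //.
have -> : face 0 (x * y : P 1%N) =
    op_comp (addn0 1) ord0 (x : P 1%N) (face 0 (y : P 1%N)).
  exact: (@face_comp_in _ P 1 0 0 (erefl 2%N) (addn0 1) ord0 0).
by rewrite face0_ueps op_compZr faceE /= face0_ueps scalerA mulrC.
Qed.
HB.instance Definition _ := GRing.isMonoidMorphism.Build ualg k^o ueps ueps_monoid.

Definition ueps_ahom : 'AHom(ualg, k^o) := linfun_ahom ueps.

End UnaryAlgebra.

(** * The module V_2 and the maps f and g *)

Section BinaryOperations.
Variables (k : fieldType) (P : comaug_operad k).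
Local Notation A := (ualg P).
Local Notation E := (P 2%N).
Local Notation u := (com_elt P 2).
Implicit Types (x y z : A) (e : E).

Definition pla x e : E := op_comp (erefl 3%N : (1 + 2 = 3)%N) ord0 (x : P 1%N) e.
Definition pr1 e y : E := op_comp (erefl 3%N : (2 + 1 = 3)%N) ord0 e (y : P 1%N).
Definition pr2 e y : E := op_comp (erefl 3%N : (2 + 1 = 3)%N) ord_max e (y : P 1%N).
Definition psw e : E := op_act e (tperm ord0 ord_max).

Lemma pla_linl e : linear (fun x => pla x e).
Proof. exact: op_comp_linl. Qed.

Lemma pla_linr x : linear (pla x).
Proof. exact: op_comp_linr. Qed.

Lemma pr1_linl y : linear (fun e => pr1 e y).
Proof. exact: op_comp_linl. Qed.

Lemma pr1_linr e : linear (pr1 e).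
Proof. exact: op_comp_linr. Qed.

Lemma pr2_linl y : linear (fun e => pr2 e y).
Proof. exact: op_comp_linl. Qed.

Lemma pr2_linr e : linear (pr2 e).
Proof. exact: op_comp_linr. Qed.

Lemma psw_lin : linear psw.
Proof. exact: (op_act_linear (tperm ord0 ord_max)). Qed.

Definition plin := (linEl pla_linl, fun x => linE (pla_linr x),
  linEl pr1_linl, fun e => linE (pr1_linr e),
  linEl pr2_linl, fun e => linE (pr2_linr e), linE psw_lin).

Lemma pla1 e : pla 1 e = e.
Proof. exact: op_1comp. Qed.

Lemma pr1_1 e : pr1 e 1 = e.
Proof. exact: op_comp1. Qed.

Lemma pr2_1 e : pr2 e 1 = e.
Proof. exact: op_comp1. Qed.

Lemma plaM x y e : pla (x * y) e = pla x (pla y e).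
Proof. exact: op_comp_seq. Qed.

Lemma pr1M e x y : pr1 e (x * y) = pr1 (pr1 e x) y.
Proof. by apply/esym; apply: op_comp_seq. Qed.

Lemma pr2M e x y : pr2 e (x * y) = pr2 (pr2 e x) y.
Proof. by apply/esym; apply: op_comp_seq. Qed.

Lemma pr12 e x y : pr1 (pr2 e y) x = pr2 (pr1 e x) y.
Proof. by apply/esym; apply: op_comp_par. Qed.

Lemma pla_pr1 x e y : pr1 (pla x e) y = pla x (pr1 e y).
Proof. exact: op_comp_seq. Qed.

Lemma pla_pr2 x e y : pr2 (pla x e) y = pla x (pr2 e y).
Proof. exact: op_comp_seq. Qed.

Lemma psw_pla x e : psw (pla x e) = pla x (psw e).
Proof.
rewrite /pla -{2}(op_act1 (x : P 1%N)); apply/esym.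
rewrite (@op_comp_act _ _ _ _ _ _ _ _ _ (tperm ord0 ord_max)) ?perm1 //.
split=> [r t tE|j t]; last by rewrite !ord1.
by rewrite perm1 !add0n; congr (nat_of_ord (tperm _ _ _)); apply: val_inj.
Qed.

Lemma psw_pr1 e y : psw (pr1 e y) = pr2 (psw e) y.
Proof.
rewrite /pr2 -{2}(op_act1 (y : P 1%N)); apply/esym.
rewrite (@op_comp_act _ _ _ _ _ _ _ _ _ (tperm ord0 ord_max)) ?tpermR //.
split=> [r t|j t].
  rewrite !ord1 => tE; have -> : t = ord_max by apply: val_inj; rewrite /= tE.
  by rewrite !tpermR.
move=> j1 tE; have j0 : j = ord0.
  by apply: val_inj; move: j1; rewrite -val_eqE /=; have := ltn_ord j; lia.
have -> : t = ord0 by apply: val_inj; rewrite /= tE j0.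
by rewrite j0 tpermL tpermR.
Qed.

Lemma psw_psw e : psw (psw e) = e.
Proof. by rewrite /psw -op_actM tperm2 op_act1. Qed.

Lemma psw_pr2 e y : psw (pr2 e y) = pr1 (psw e) y.
Proof. by rewrite -[RHS]psw_psw psw_pr1 psw_psw. Qed.

Lemma psw_u : psw u = u.
Proof. exact: com_elt_act. Qed.

(** The face 1 removes the second input and thereby restricts to the first. *)
Definition restr1 e : A := face 1 e.
Definition restr2 e : A := face 0 e.

Lemma restr1_lin : linear restr1.
Proof. exact: face_linear. Qed.

Lemma restr2_lin : linear restr2.
Proof. exact: face_linear. Qed.

Definition rlin := (linE restr1_lin, linE restr2_lin).

Lemma restr1_u : restr1 u = 1. Proof. exact: face_com. Qed.
Lemma restr2_u : restr2 u = 1. Proof. exact: face_com. Qed.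

Lemma restr1_pla x e : restr1 (pla x e) = x * restr1 e.
Proof. exact: (@face_comp_in _ P 1 1 1 _ (erefl 2%N) ord0 1). Qed.

Lemma restr2_pla x e : restr2 (pla x e) = x * restr2 e.
Proof. exact: (@face_comp_in _ P 1 1 1 _ (erefl 2%N) ord0 0). Qed.

Lemma restr1_pr1 e y : restr1 (pr1 e y) = restr1 e * y.
Proof. exact: (@face_comp_out _ P 1 1 1 _ (erefl 2%N) ord0 ord_max ord0). Qed.

Lemma restr2_pr1 e y : restr2 (pr1 e y) = ueps y *: restr2 e.
Proof.
rewrite /restr2 (@face_comp_in _ P 2 0 1 _ (addn0 2) ord0 0) //.
by rewrite face0_ueps op_compZr faceE.
Qed.

Lemma restr2_pr2 e y : restr2 (pr2 e y) = restr2 e * y.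
Proof. exact: (@face_comp_out _ P 1 1 1 _ (erefl 2%N) ord_max ord0 ord0). Qed.

Lemma restr1_pr2 e y : restr1 (pr2 e y) = ueps y *: restr1 e.
Proof.
rewrite /restr1 (@face_comp_in _ P 2 0 1 _ (addn0 2) ord_max 0) //.
by rewrite face0_ueps op_compZr faceE.
Qed.

Lemma restr_psw e : restr1 (psw e) = restr2 e /\ restr2 (psw e) = restr1 e.
Proof.
have perm1E (s : 'S_1) : s = 1%g by apply/permP => i; rewrite !ord1.
split; [have [s' s'P] := face_act (tperm ord0 ord_max) (ord_max : 'I_2)
       |have [s' s'P] := face_act (tperm ord0 ord_max) (ord0 : 'I_2)].
  by rewrite /restr1 (s'P k P) tpermR (perm1E s') op_act1.
by rewrite /restr2 (s'P k P) tpermL (perm1E s') op_act1.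
Qed.

Lemma ueps_restr e : ueps (restr1 e) = ueps (restr2 e).
Proof. by rewrite /ueps /restr1 face_face. Qed.

Definition restrE := (restr1_u, restr2_u, restr1_pla, restr2_pla, restr1_pr1,
  restr2_pr1, restr1_pr2, restr2_pr2).

Definition prim : {vspace E} :=
  (lker (linfun (@face k P 1 0)) :&: lker (linfun (@face k P 1 1)))%VS.

Lemma primP e : reflect (restr1 e = 0 /\ restr2 e = 0) (e \in prim).
Proof.
rewrite memv_cap !memv_ker !lfunE /=.
by apply: (iffP andP) => [[/eqP e0 /eqP e1]|[e0 e1]]; split=> //; apply/eqP.
Qed.

Local Notation M := (subvs_of prim).
Local Notation Abar := (subvs_of (aug_ideal (ueps_ahom P))).
Implicit Types (mu : M) (a b c : Abar).

(** Total, so that the structure maps can be defined before their values are known to lie in [prim];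
    [inME] and its consequences supply this. *)
Definition inM e : M := vsproj prim e.

Lemma inME e : restr1 e = 0 -> restr2 e = 0 -> vsval (inM e) = e.
Proof. by move=> e1 e2; rewrite vsprojK //; apply/primP. Qed.

Lemma restr1_M mu : restr1 (vsval mu) = 0.
Proof. by have [] := primP _ (subvsP mu). Qed.

Lemma restr2_M mu : restr2 (vsval mu) = 0.
Proof. by have [] := primP _ (subvsP mu). Qed.

Lemma ueps_Abar a : ueps (vsval a) = 0.
Proof. by have := subvsP a; rewrite memv_ker lfunE => /eqP. Qed.

Definition glact x mu : M := inM (pla x (vsval mu)).
Definition gract mu x y : M := inM (pr2 (pr1 (vsval mu) x) y).
Definition gact mu (s : 'S_2) : M := inM (op_act (vsval mu) s).
(** The primitive part of a o 1_2, whose two restrictions both equal [a]. *)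
Definition gf a : M := inM (pla (vsval a) u - pr1 u (vsval a) - pr2 u (vsval a)).
Definition gg a b : M := inM (pr2 (pr1 u (vsval a)) (vsval b)).

Lemma glactE x mu : vsval (glact x mu) = pla x (vsval mu).
Proof. by rewrite inME // restrE ?restr1_M ?restr2_M mulr0. Qed.

Lemma gractE mu x y : vsval (gract mu x y) = pr2 (pr1 (vsval mu) x) y.
Proof. by rewrite inME // !restrE ?restr1_M ?restr2_M !(mul0r, scaler0). Qed.

Lemma gactE mu s : vsval (gact mu s) = op_act (vsval mu) s.
Proof.
have face0 (i : 'I_2) : face i (op_act (vsval mu) s) = 0.
  have [s' ->] := face_act s i.
  have -> : face (s i) (vsval mu) = 0; last by rewrite op_act0.
  case: (s i) => [[|[|//]] ?] /=; [exact: restr2_M|exact: restr1_M].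
by rewrite inME //; [apply: (face0 ord_max)|apply: (face0 ord0)].
Qed.

Lemma gfE a : vsval (gf a) = pla (vsval a) u - pr1 u (vsval a) - pr2 u (vsval a).
Proof.
by rewrite inME // !rlin !restrE ueps_Abar scale0r mulr1 mul1r ?subr0 ?subrr.
Qed.

Lemma ggE a b : vsval (gg a b) = pr2 (pr1 u (vsval a)) (vsval b).
Proof. by rewrite inME // !restrE ?ueps_Abar !(mul0r, scale0r, scaler0). Qed.

Lemma gactP : right_perm_action gact.
Proof.
split=> [s c x y|v|v s t]; apply: vsval_inj.
- by rewrite vsval_linear !gactE vsval_linear op_actD op_actZ.
- by rewrite gactE op_act1.
- by rewrite !gactE op_actM.
Qed.

Hypothesis prim_neq0 : prim != 0%VS.

Lemma gmod_neq0 : {: M}%VS != 0%VS.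
Proof.
by apply: contra prim_neq0; rewrite -!dimv_eq0 dimvf.
Qed.

Let vl := @vsval_linear k _ prim.
Let va := @vsval_linear k _ (aug_ideal (ueps_ahom P)).
Let vE := (glactE, gractE, gactE, gfE, ggE, linE vl, linE va).

Lemma glact_linl mu : linear (fun x => glact x mu).
Proof. by move=> c x y; apply: vsval_inj; rewrite !vE !plin. Qed.

Lemma glact_linr x : linear (glact x).
Proof. by move=> c mu nu; apply: vsval_inj; rewrite !vE !plin. Qed.

Lemma glact1 mu : glact 1 mu = mu.
Proof. by apply: vsval_inj; rewrite glactE pla1. Qed.

Lemma glactM x y mu : glact (x * y) mu = glact x (glact y mu).
Proof. by apply: vsval_inj; rewrite !glactE plaM. Qed.

Lemma gract_lin x y : linear (fun mu => gract mu x y).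
Proof. by move=> c mu nu; apply: vsval_inj; rewrite !vE !plin. Qed.

Lemma gract_linl mu y : linear (fun x => gract mu x y).
Proof. by move=> c x x'; apply: vsval_inj; rewrite !vE !plin. Qed.

Lemma gract_linr mu x : linear (gract mu x).
Proof. by move=> c y y'; apply: vsval_inj; rewrite !vE !plin. Qed.

Lemma gract1 mu : gract mu 1 1 = mu.
Proof. by apply: vsval_inj; rewrite gractE pr1_1 pr2_1. Qed.

Lemma gractM mu x y z t : gract mu (x * z) (y * t) = gract (gract mu x y) z t.
Proof. by apply: vsval_inj; rewrite !gractE pr1M pr2M pr12. Qed.

Lemma glract x mu y z : glact x (gract mu y z) = gract (glact x mu) y z.
Proof. by apply: vsval_inj; rewrite !(glactE, gractE) pla_pr1 pla_pr2. Qed.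

Lemma glact_act x mu : glact x (gact mu (tperm ord0 ord_max)) =
  gact (glact x mu) (tperm ord0 ord_max).
Proof.
by apply: vsval_inj; rewrite !(glactE, gactE) -!/(psw _) psw_pla.
Qed.

Lemma gract_act mu x y : gact (gract mu x y) (tperm ord0 ord_max) =
  gract (gact mu (tperm ord0 ord_max)) y x.
Proof.
by apply: vsval_inj; rewrite !(gractE, gactE) -!/(psw _) psw_pr2 psw_pr1 pr12.
Qed.

Lemma gf_lin : linear gf.
Proof.
move=> c a b; apply: vsval_inj; rewrite !vE !plin.
by apply: eq_by_functionals => phi pD pN pZ; rewrite !(pD, pN, pZ); ring.
Qed.

Lemma gf_act a : gact (gf a) (tperm ord0 ord_max) = gf a.
Proof.
apply: vsval_inj; rewrite !(gfE, gactE) -/(psw _) !plin psw_pla psw_pr1 psw_pr2.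
by rewrite psw_u addrAC.
Qed.

Lemma gg_linl b : linear (fun a => gg a b).
Proof. by move=> c a a'; apply: vsval_inj; rewrite !vE !plin. Qed.

Lemma gg_linr a : linear (gg a).
Proof. by move=> c b b'; apply: vsval_inj; rewrite !vE !plin. Qed.

Lemma gg_ract a b x y : gg (aug_mulr a x) (aug_mulr b y) = gract (gg a b) x y.
Proof. by apply: vsval_inj; rewrite gractE !ggE /= pr1M pr2M pr12. Qed.

Lemma gg_act a b : gact (gg a b) (tperm ord0 ord_max) = gg b a.
Proof.
apply: vsval_inj; rewrite gactE !ggE -/(psw _) psw_pr2 psw_pr1 psw_u.
by rewrite pr12.
Qed.

(** Expansion of (a b) o 1_2 = a o (b o 1_2). *)
Lemma gfM a b : gf (aug_mulr a (vsval b)) =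
  glact (vsval a) (gf b) + gract (gf a) (vsval b) 1
      + gract (gf a) 1 (vsval b) + gg a b + gg b a.
Proof.
apply: vsval_inj; rewrite !vE /= pr1_1 !pr2_1 plaM !plin pr1M pr2M.
rewrite !(pla_pr1, pla_pr2) pr12.
by apply: eq_by_functionals => phi pD pN pZ; rewrite !(pD, pN, pZ); ring.
Qed.

(** Expansion of (a o 1_2)(b, c) = a o (1_2 (b, c)). *)
Lemma gf_ract a b c : gract (gf a) (vsval b) (vsval c) =
  glact (vsval a) (gg b c) - gg (aug_mulr a (vsval b)) c
      - gg b (aug_mulr a (vsval c)).
Proof.
apply: vsval_inj; rewrite !vE /= !plin pr1M pr2M !(pla_pr1, pla_pr2) pr12.
by apply: eq_by_functionals => phi pD pN pZ; rewrite !(pD, pN, pZ); ring.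
Qed.

Definition operad_trident : trident k :=
  @Trident k A (ueps_ahom P) M glact gract gact gf gg gmod_neq0
    glact_linl glact_linr glact1 glactM gract_lin gract_linl gract_linr gract1
    gractM glract gactP glact_act gract_act gf_lin gf_act gg_linl gg_linr
    gg_ract gg_act gfM gf_ract.

End BinaryOperations.

(** * Action on morphisms *)

Section TridentOfHom.
Variables (k : fieldType) (P Q : comaug_operad k).
Hypotheses (hP : prim P != 0%VS) (hQ : prim Q != 0%VS).
Variable h : comaug_hom P Q.

Lemma hom_pla x e : h 2%N (pla x e) = pla (h 1%N x : ualg Q) (h 2%N e).
Proof. exact: oh_comp. Qed.

Lemma hom_pr1 e y : h 2%N (pr1 e y) = pr1 (h 2%N e) (h 1%N y : ualg Q).
Proof. exact: oh_comp. Qed.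

Lemma hom_pr2 e y : h 2%N (pr2 e y) = pr2 (h 2%N e) (h 1%N y : ualg Q).
Proof. exact: oh_comp. Qed.

Lemma hom_ahom_in : ahom_in {: ualg P} (h 1%N : 'Hom(ualg P, ualg Q)).
Proof.
apply/ahomP_tmp; split; first exact: comaug_hom_com.
by move=> x y; apply: oh_comp.
Qed.

Definition hom_alg : 'AHom(ualg P, ualg Q) := AHom hom_ahom_in.

Definition hom_prim (mu : subvs_of (prim P)) : subvs_of (prim Q) :=
  inM (h 2%N (vsval mu)).

Lemma hom_primE mu : vsval (hom_prim mu) = h 2%N (vsval mu).
Proof.
by rewrite inME // /restr1 /restr2 -comaug_hom_face -/(restr1 _) -/(restr2 _)
  ?restr1_M ?restr2_M linear0.
Qed.

Lemma hom_prim_linear : linear hom_prim.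
Proof.
by move=> c x y; apply: vsval_inj; rewrite vsval_linear !hom_primE vsval_linear linearP.
Qed.
HB.instance Definition _ := GRing.isLinear.Build k (subvs_of (prim P))
  (subvs_of (prim Q)) *:%R hom_prim hom_prim_linear.

Lemma hom_ueps x : ueps (hom_alg x) = ueps x.
Proof.
rewrite /ueps -[hom_alg x]/(h 1%N x) -comaug_hom_face face0_ueps linearZ_LR /=.
by rewrite comaug_hom_com !val0_scale.
Qed.

Local Notation TP := (operad_trident hP).
Local Notation TQ := (operad_trident hQ).

Lemma hom_eps (x : td_alg TP) : td_eps TQ (hom_alg x) = td_eps TP x.
Proof. by rewrite !lfunE /= hom_ueps. Qed.

Lemma aug_restr_hom (a : subvs_of (td_ideal TP)) :
  vsval (@aug_restr k TP TQ hom_alg a) = h 1%N (vsval a : ualg P).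
Proof. by rewrite (@aug_restrE k TP TQ) //; apply: hom_eps. Qed.

Lemma hom_act (mu : td_mod TP) s :
  linfun hom_prim (td_act mu s) = td_act (linfun hom_prim mu : td_mod TQ) s.
Proof.
rewrite !lfunE; apply: vsval_inj.
by rewrite /= hom_primE !gactE hom_primE oh_act.
Qed.

Lemma hom_lact (x : td_alg TP) (mu : td_mod TP) :
  linfun hom_prim (td_lact x mu) =
  td_lact (hom_alg x : td_alg TQ) (linfun hom_prim mu).
Proof.
rewrite !lfunE; apply: vsval_inj.
by rewrite /= hom_primE !glactE hom_primE hom_pla.
Qed.

Lemma hom_ract (mu : td_mod TP) (x y : td_alg TP) :
  linfun hom_prim (td_ract mu x y) =
  td_ract (linfun hom_prim mu : td_mod TQ) (hom_alg x) (hom_alg y).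
Proof.
rewrite !lfunE; apply: vsval_inj.
by rewrite /= hom_primE !gractE hom_primE hom_pr2 hom_pr1.
Qed.

Lemma hom_f (a : subvs_of (td_ideal TP)) :
  linfun hom_prim (td_f a) = td_f (@aug_restr k TP TQ hom_alg a).
Proof.
rewrite lfunE; apply: vsval_inj; rewrite /= hom_primE !gfE aug_restr_hom.
by rewrite !linearB /= hom_pla hom_pr1 hom_pr2 comaug_hom_com.
Qed.

Lemma hom_g (a b : subvs_of (td_ideal TP)) :
  linfun hom_prim (td_g a b) =
  td_g (@aug_restr k TP TQ hom_alg a) (@aug_restr k TP TQ hom_alg b).
Proof.
rewrite lfunE; apply: vsval_inj; rewrite /= hom_primE !ggE !aug_restr_hom.
by rewrite hom_pr2 hom_pr1 comaug_hom_com.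
Qed.

Definition trident_of_hom : trident_hom TP TQ :=
  @TridentHom k TP TQ hom_alg (linfun hom_prim) hom_eps hom_act hom_lact
    hom_ract hom_f hom_g.

End TridentOfHom.

Lemma ueps_lin (k : fieldType) (P : comaug_operad k) (c : k) (x y : ualg P) :
  ueps (c *: x + y) = c * (ueps x : k) + (ueps y : k) :> k.
Proof. exact: ueps_linear. Qed.

Lemma ueps_scalar (k : fieldType) (P : comaug_operad k) (c : k) :
  ueps (c *: (1 : ualg P)) = c.
Proof.
rewrite -[c *: _]addr0 ueps_lin (ueps_monoid P).1.
by rewrite (linE (@ueps_linear k P)).2 mulr1 addr0.
Qed.

(** * Full faithfulness *)

Section FullyFaithful.
Variables (k : fieldType) (P Q : comaug_operad k).
Hypotheses (hP : prim P != 0%VS) (hQ : prim Q != 0%VS).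
Local Notation TP := (operad_trident hP).
Local Notation TQ := (operad_trident hQ).

(** Inclusion-exclusion: the scalar part of [e] is removed with each of the two restrictions and is
    restored once. *)
Definition prim_part (O : comaug_operad k) (e : O 2%N) : O 2%N :=
  e - pr1 (com_elt O 2) (restr1 e) - pr2 (com_elt O 2) (restr2 e)
    + ueps (restr2 e) *: com_elt O 2.

Lemma prim_partE (O : comaug_operad k) (e : O 2%N) :
  vsval (inM (prim_part e)) = prim_part e.
Proof.
rewrite inME // /prim_part !rlin !restrE ?ueps_restr mul1r.
  by rewrite subrr sub0r addNr.
by rewrite addrAC subrK subrr.
Qed.

Lemma binary_decomp (O : comaug_operad k) (e : O 2%N) :
  e = pr1 (com_elt O 2) (restr1 e) + pr2 (com_elt O 2) (restr2 e)
    - ueps (restr2 e) *: com_elt O 2 + vsval (inM (prim_part e)).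
Proof.
rewrite prim_partE /prim_part.
by apply: eq_by_functionals => phi pD pN pZ; rewrite !(pD, pN, pZ); ring.
Qed.

Lemma trident_of_hom_inj (h h' : comaug_hom P Q) : coskeletal 2 Q ->
  trident_of_hom hP hQ h = trident_of_hom hP hQ h' -> h = h'.
Proof.
move=> cosk hh.
have h1 x : h 1%N x = h' 1%N x.
  exact: (congr1 (fun t : trident_hom TP TQ => th_alg t (x : td_alg TP)) hh).
have hM (mu : td_mod TP) : h 2%N (vsval mu) = h' 2%N (vsval mu).
  rewrite -!hom_primE; congr vsval.
  have /= := congr1 (fun t : trident_hom TP TQ => th_mod t mu) hh.
  by rewrite !lfunE.
have lin2 (g : comaug_hom P Q) : linear (g 2%N) by exact: linearP.
apply: comaug_hom_determined => // e.
rewrite (binary_decomp e) !(linE (lin2 h)) !(linE (lin2 h')).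
by rewrite !(hom_pr1, hom_pr2) !comaug_hom_com !h1 hM.
Qed.

Section Full.
Variable t : trident_hom TP TQ.
Let al (x : ualg P) : ualg Q := th_alg t (x : td_alg TP).
Let be (mu : subvs_of (prim P)) : subvs_of (prim Q) := th_mod t (mu : td_mod TP).
Local Notation uP := (com_elt P 2).
Local Notation uQ := (com_elt Q 2).

Let al_lin : linear al.
Proof. by move=> c x y; rewrite /al linearP. Qed.

Let be_lin : linear be.
Proof. by move=> c x y; rewrite /be linearP. Qed.

Let al1 : al 1 = 1.
Proof. exact: rmorph1. Qed.

Let alM x y : al (x * y) = al x * al y.
Proof. exact: rmorphM. Qed.

Let al_eps x : ueps (al x) = ueps x.
Proof. by have := th_eps t x; rewrite !lfunE. Qed.

Let al_bar (a : subvs_of (td_ideal TP)) :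
  vsval (aug_restr (th_alg t) a) = al (vsval a).
Proof. by rewrite aug_restrE //; apply: th_eps. Qed.

(** By [binary_decomp] a morphism that induces [t] can take no other value. *)
Definition ext2 (e : P 2%N) : Q 2%N :=
  pr1 uQ (al (restr1 e)) + pr2 uQ (al (restr2 e)) - ueps (restr2 e) *: uQ
    + vsval (be (inM (prim_part e))).

Lemma ext2_lin : linear ext2.
Proof.
move=> c e e'; rewrite /ext2.
have -> : inM (prim_part (c *: e + e')) = c *: inM (prim_part e) + inM (prim_part e').
  apply: vsval_inj; rewrite vsval_linear !prim_partE /prim_part.
  rewrite restr1_lin restr2_lin ueps_lin !plin.
  by apply: eq_by_functionals => phi pD pN pZ; rewrite !(pD, pN, pZ); ring.
rewrite be_lin vsval_linear restr1_lin restr2_lin ueps_lin !al_lin !plin.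
by apply: eq_by_functionals => phi pD pN pZ; rewrite !(pD, pN, pZ); ring.
Qed.

Lemma ext2_prim mu : ext2 (vsval mu) = vsval (be mu).
Proof.
have partE : prim_part (vsval mu) = vsval mu.
  rewrite /prim_part restr1_M restr2_M !plin (linE (@ueps_linear k P)).2.
  by rewrite scale0r !subr0 addr0.
rewrite /ext2 restr1_M restr2_M (linE al_lin).2 !plin partE.
rewrite (linE (@ueps_linear k P)).2 scale0r subr0 !add0r.
by congr (vsval (be _)); apply: vsval_inj; rewrite -[in LHS]partE prim_partE.
Qed.

Let prim_part_pr1 x : inM (prim_part (pr1 uP x)) = 0.
Proof.
apply: vsval_inj; rewrite prim_partE /prim_part !restrE !plin pr2_1 mul1r.
by rewrite ueps_scalar subrr sub0r addNr.
Qed.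

Lemma ext2_pr1 x : ext2 (pr1 uP x) = pr1 uQ (al x).
Proof.
rewrite /ext2 !restrE mul1r (linE al_lin) al1 !plin pr2_1 prim_part_pr1.
by rewrite (linE be_lin).2 ueps_scalar addrK addr0.
Qed.

Lemma ext2_u : ext2 uP = uQ.
Proof. by rewrite -{1}[uP]pr1_1 ext2_pr1 al1 pr1_1. Qed.

Lemma ext2_restr1 e : restr1 (ext2 e) = al (restr1 e).
Proof.
rewrite /ext2 !rlin !restrE restr1_M mul1r al_eps addr0.
by rewrite addrK.
Qed.

Lemma ext2_restr2 e : restr2 (ext2 e) = al (restr2 e).
Proof.
rewrite /ext2 !rlin !restrE restr2_M mul1r al_eps ueps_restr addr0.
by rewrite addrAC subrr add0r.
Qed.

Lemma binary_ind (V : lmodType k) (F G : P 2%N -> V) :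
  linear F -> linear G ->
  (forall x, F (pr1 uP x) = G (pr1 uP x)) ->
  (forall x, F (pr2 uP x) = G (pr2 uP x)) ->
  (forall mu : subvs_of (prim P), F (vsval mu) = G (vsval mu)) -> F =1 G.
Proof.
move=> Fl Gl F1 F2 FM e; rewrite (binary_decomp e).
rewrite !(linE Fl) !(linE Gl) F1 F2 FM; congr (_ - _ *: _ + _).
by rewrite -[uP]pr1_1.
Qed.

Let ext2_comp (V : lmodType k) (F : V -> P 2%N) (hF : linear F) :
  linear (fun v => ext2 (F v)).
Proof. by move=> c v w; rewrite hF ext2_lin. Qed.

Lemma ext2_psw e : ext2 (psw e) = psw (ext2 e).
Proof.
have [r1 r2] := restr_psw e.
have part_sw : prim_part (psw e) = psw (prim_part e).
  rewrite /prim_part r1 r2 !plin psw_pr1 psw_pr2 psw_u ueps_restr.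
  by congr (_ + _); rewrite addrAC.
rewrite /ext2 r1 r2 part_sw; move: (prim_part e) (prim_partE e) => v vE.
rewrite !plin !psw_pr1 !psw_pr2 !psw_u ueps_restr.
congr (_ - _ + _); first by rewrite addrC.
have <- : gact (inM v) (tperm ord0 ord_max) = inM (psw v) by rewrite /gact vE.
by rewrite [be _](th_act t) /= gactE.
Qed.

Lemma ext2_pr2 x : ext2 (pr2 uP x) = pr2 uQ (al x).
Proof. by rewrite -{1}psw_u -psw_pr1 ext2_psw ext2_pr1 psw_pr1 psw_u. Qed.

Let vsval_bar x : vsval (@abar k TP x) = x - ueps x *: 1.
Proof. by rewrite abarE /aug lfunE. Qed.

(** On the augmentation ideals this is the compatibility of [t] with g. The terms by which [x] and
    [y] differ from their bars involve only unary substitutions into 1_2 at one input, which are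
    settled. *)
Lemma ext2_pr12 x y : ext2 (pr2 (pr1 uP x) y) = pr2 (pr1 uQ (al x)) (al y).
Proof.
pose xb : subvs_of (td_ideal TP) := @abar k TP x.
pose yb : subvs_of (td_ideal TP) := @abar k TP y.
have gE : ext2 (pr2 (pr1 uP (vsval xb)) (vsval yb)) =
    pr2 (pr1 uQ (al (vsval xb))) (al (vsval yb)).
  rewrite -ggE ext2_prim [be _](th_g t) /=.
  by rewrite [LHS]ggE !al_bar.
move: gE; rewrite !vsval_bar !(linE al_lin) al1 !plin !pr1_1 !pr2_1.
rewrite !(linE ext2_lin) !ext2_pr1 !ext2_pr2 ext2_u => gE.
apply: eq_by_functionals => phi pD pN pZ.
have := congr1 phi gE; rewrite !(pD, pN, pZ) => /eq_shift; apply; ring.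
Qed.

Lemma ext2_pla_u x : ext2 (pla x uP) = pla (al x) uQ.
Proof.
pose xb : subvs_of (td_ideal TP) := @abar k TP x.
have fE : ext2 (vsval (gf xb)) =
    pla (al (vsval xb)) uQ - pr1 uQ (al (vsval xb)) - pr2 uQ (al (vsval xb)).
  rewrite ext2_prim [be _](th_f t) /=.
  by rewrite [LHS]gfE !al_bar.
move: fE; rewrite gfE !vsval_bar !(linE al_lin) al1 !plin !pr1_1 !pr2_1 !pla1.
rewrite !(linE ext2_lin) !ext2_pr1 !ext2_pr2 ext2_u => fE.
apply: eq_by_functionals => phi pD pN pZ.
have := congr1 phi fE; rewrite !(pD, pN, pZ) => /eq_shift; apply; ring.
Qed.

Lemma ext2_comp_pr1 e y : ext2 (pr1 e y) = pr1 (ext2 e) (al y).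
Proof.
apply: (binary_ind (F := fun e => ext2 (pr1 e y))
  (G := fun e => pr1 (ext2 e) (al y))) => [|c e1 e2|x|x|mu].
- exact: ext2_comp (pr1_linl y).
- by rewrite ext2_lin !plin.
- by rewrite -pr1M !ext2_pr1 alM pr1M.
- by rewrite pr12 ext2_pr12 ext2_pr2 pr12.
- have -> : pr1 (vsval mu) y = vsval (gract mu y 1) by rewrite gractE pr2_1.
  by rewrite !ext2_prim [be _](th_ract t) [LHS]gractE -/(al _) -/(al _) al1 pr2_1.
Qed.

Lemma ext2_comp_pr2 e y : ext2 (pr2 e y) = pr2 (ext2 e) (al y).
Proof.
rewrite -{1}[e]psw_psw -psw_pr1 ext2_psw ext2_comp_pr1 psw_pr1.
by rewrite ext2_psw psw_psw.
Qed.

Lemma ext2_comp_pla x e : ext2 (pla x e) = pla (al x) (ext2 e).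
Proof.
apply: (binary_ind (F := fun e => ext2 (pla x e))
  (G := fun e => pla (al x) (ext2 e))) => [|c e1 e2|y|y|mu].
- exact: ext2_comp (pla_linr x).
- by rewrite ext2_lin !plin.
(* Since left and right actions commute, [x] can be made to act on 1_2 itself, where [ext2_pla_u]
   applies. *)
- by rewrite -pla_pr1 ext2_comp_pr1 ext2_pla_u ext2_pr1 pla_pr1.
- by rewrite -pla_pr2 ext2_comp_pr2 ext2_pla_u ext2_pr2 pla_pr2.
- by rewrite -glactE !ext2_prim [be _](th_lact t) [LHS]glactE.
Qed.

Lemma trident_of_hom_surj : coskeletal 2 Q ->
  exists h : comaug_hom P Q, trident_of_hom hP hQ h = t.
Proof.
move=> cosk; pose phi0 (x : P 0%N) : Q 0%N := val0 x *: com_elt Q 0.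
have [|||||||||||||h [h1 h2]] := @comaug_hom_extend k P Q phi0 al ext2.
- move=> c x y; rewrite /phi0 scalerA -scalerDl; congr (_ *: _).
  rewrite [in LHS](val0E x) [in LHS](val0E y) scalerA -scalerDl.
  by rewrite val0_scale.
- exact: al_lin.
- exact: ext2_lin.
- by rewrite /phi0 -[com_elt P 0]scale1r val0_scale scale1r.
- exact: al1.
- exact: ext2_u.
- by move=> x; rewrite face0_ueps al_eps.
- by move=> [|[|i]] // x _; [exact: ext2_restr2|exact: ext2_restr1].
- exact: ext2_psw.
- move=> e i x y; rewrite (ord1 i) (eq_irrelevance e (erefl 2%N)); exact: alM.
- move=> e i x y; rewrite (ord1 i) (eq_irrelevance e (erefl 3%N)).
  exact: ext2_comp_pla.
- move=> e i x y; rewrite (eq_irrelevance e (erefl 3%N)).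
  have [->|->] : i = ord0 \/ i = ord_max.
  + by case: i => [[|[|?]] ?] //; [left|right]; apply: val_inj.
  + exact: ext2_comp_pr1.
  + exact: ext2_comp_pr2.
- exact: cosk.
exists h; apply: trident_hom_ext => [x|mu]; first exact: h1.
by rewrite /= lfunE; apply: vsval_inj; rewrite /= hom_primE h2 ext2_prim.
Qed.

End Full.
End FullyFaithful.

(** * The equivalence *)

Section Inverse.
Variables (k : fieldType) (S T : trident k) (t : trident_hom S T).
Variables (al' : td_alg T -> td_alg S) (be' : td_mod T -> td_mod S).
Hypotheses (alK : cancel (th_alg t) al') (alVK : cancel al' (th_alg t)).
Hypotheses (beK : cancel (th_mod t) be') (beVK : cancel be' (th_mod t)).

Lemma inv_alg_linear : linear al'.
Proof. by move=> c x y; apply: (can_inj alK); rewrite linearP /= !alVK. Qed.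

Lemma inv_mod_linear : linear be'.
Proof. by move=> c x y; apply: (can_inj beK); rewrite linearP /= !beVK. Qed.

HB.instance Definition _ :=
  GRing.isLinear.Build k (td_alg T) (td_alg S) *:%R al' inv_alg_linear.
HB.instance Definition _ :=
  GRing.isLinear.Build k (td_mod T) (td_mod S) *:%R be' inv_mod_linear.

Lemma inv_alg_monoid : monoid_morphism al'.
Proof.
split=> [|x y]; apply: (can_inj alK); first by rewrite alVK rmorph1.
by rewrite rmorphM /= !alVK.
Qed.
HB.instance Definition _ :=
  GRing.isMonoidMorphism.Build (td_alg T) (td_alg S) al' inv_alg_monoid.

Lemma trident_hom_inverse : exists t' : trident_hom T S,
  trident_hom_comp t t' = trident_hom_id T /\
  trident_hom_comp t' t = trident_hom_id S.
Proof.
pose a := linfun_ahom al'; pose b := linfun be'.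
have aE x : a x = al' x by rewrite lfunE.
have bE x : b x = be' x by rewrite lfunE.
have a_eps x : td_eps S (a x) = td_eps T x by rewrite aE -(th_eps t) alVK.
have restrK (x : subvs_of (td_ideal T)) : aug_restr (th_alg t) (aug_restr a x) = x.
  apply: vsval_inj; rewrite aug_restrE; last exact: th_eps.
  by rewrite aug_restrE // aE alVK.
have b_act mu s : b (td_act mu s) = td_act (b mu) s.
  by apply: (can_inj beK); rewrite th_act !bE !beVK.
have b_lact x mu : b (td_lact x mu) = td_lact (a x) (b mu).
  by apply: (can_inj beK); rewrite th_lact !bE !beVK aE alVK.
have b_ract mu x y : b (td_ract mu x y) = td_ract (b mu) (a x) (a y).
  by apply: (can_inj beK); rewrite th_ract !bE !beVK !aE !alVK.
have b_f (x : subvs_of (td_ideal T)) : b (td_f x) = td_f (aug_restr a x).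
  by apply: (can_inj beK); rewrite th_f bE beVK restrK.
have b_g (x y : subvs_of (td_ideal T)) :
    b (td_g x y) = td_g (aug_restr a x) (aug_restr a y).
  by apply: (can_inj beK); rewrite th_g bE beVK !restrK.
exists (@TridentHom k T S a b a_eps b_act b_lact b_ract b_f b_g).
by split; apply: trident_hom_ext => x;
  rewrite /= comp_lfunE id_lfunE ?aE ?bE ?alK ?beK ?alVK ?beVK.
Qed.

End Inverse.

(** * Recovering a trident algebra from its operad *)

Section EssentiallySurjective.
Variables (k : fieldType) (T : trident k).
Local Notation FT := (trident_comaug T).
Local Notation A := (td_alg T).
Local Notation M := (td_mod T).

Lemma prim_trident (e : FT 2%N) : e \in prim FT ->
  [/\ cf e = 0, av e 0 = 0 & av e 1 = 0].
Proof.
move=> /primP[e1 e2]; split.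
- by rewrite -(cf_face e (leq0n 1)) [face 0 e]e2.
- by rewrite -(@av_face k T 1 1 e _ 0) // [face 1 e]e1 av0.
- by rewrite -(@av_face k T 1 0 e _ 1) // [face 0 e]e2 av0.
Qed.

Lemma prim_trident_eq (mu nu : subvs_of (prim FT)) :
  mv (vsval mu : tcarrier T 2) 0 1 = mv (vsval nu : tcarrier T 2) 0 1 -> mu = nu.
Proof.
have [mc m0 m1] := prim_trident (subvsP mu).
have [nc n0 n1] := prim_trident (subvsP nu).
move=> mn; apply: vsval_inj; apply: (@tcarrier_eq k T 2).
- by rewrite mc nc.
- by move=> [|[|t]] // _; rewrite ?m0 ?n0 ?m1 ?n1.
- by move=> [|[|t]] [|[|u]].
Qed.

Definition to_prim (mu : M) : subvs_of (prim FT) := inM (tmod mu : FT 2%N).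

Lemma to_primE mu : vsval (to_prim mu) = tmod mu.
Proof. by rewrite inME //; apply: face_tmod. Qed.

Lemma to_primK : cancel to_prim (fun nu => mv (vsval nu : tcarrier T 2) 0 1).
Proof. by move=> mu; rewrite to_primE mv_tmod. Qed.

Lemma to_primVK : cancel (fun nu => mv (vsval nu : tcarrier T 2) 0 1) to_prim.
Proof. by move=> nu; apply: prim_trident_eq; rewrite to_primK. Qed.

Lemma to_prim_linear : linear to_prim.
Proof.
by move=> c x y; apply: prim_trident_eq; rewrite vsval_linear mv_lin !to_primK.
Qed.
HB.instance Definition _ := GRing.isLinear.Build k M (subvs_of (prim FT)) *:%R
  to_prim to_prim_linear.

Lemma trident_prim_neq0 : prim FT != 0%VS.
Proof.
have : vpick {: M}%VS != 0 by rewrite vpick0 td_mod_neq0.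
apply: contra_neq => p0; apply: (can_inj to_primK); rewrite linear0.
by apply: vsval_inj; apply/eqP; rewrite -memv0 -p0 subvsP.
Qed.

Definition to_unary (x : A) : ualg FT := tmk 1 (aug x) (fun=> x) (fun _ _ => 0).
Definition of_unary (X : ualg FT) : A := av (X : tcarrier T 1) 0.

Lemma to_unaryK : cancel to_unary of_unary.
Proof. by move=> x; apply: av_mk. Qed.

Lemma of_unaryK : cancel of_unary to_unary.
Proof.
move=> X; apply: (@tcarrier_eq k T 1) => [|t t1|t u]; last by lia.
  by rewrite cf_mk aug_av.
have -> : t = 0%N by lia.
exact: to_unaryK.
Qed.

Lemma to_unary_linear : linear to_unary.
Proof.
move=> c x y; apply: (can_inj of_unaryK).
by rewrite to_unaryK [RHS]av_lin -!/(of_unary _) !to_unaryK.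
Qed.
HB.instance Definition _ :=
  GRing.isLinear.Build k A (ualg FT) *:%R to_unary to_unary_linear.

Lemma to_unary_monoid : monoid_morphism to_unary.
Proof.
split=> [|x y]; apply: (can_inj of_unaryK); rewrite to_unaryK.
  transitivity (av (com_elt FT 1 : tcarrier T 1) 0) => //.
  by rewrite com_elt_trident av_one.
pose X : tcarrier T 1 := to_unary x; pose Y : tcarrier T 1 := to_unary y.
transitivity (av (tcomp 1 0 X Y) (0 + 0)) => //.
rewrite (av_in (erefl 2%N : (1 + 1 = 2)%N)) //.
by rewrite -[av X 0]/(of_unary _) -[av Y 0]/(of_unary _) !to_unaryK.
Qed.
HB.instance Definition _ :=
  GRing.isMonoidMorphism.Build A (ualg FT) to_unary to_unary_monoid.

Lemma ueps_trident (X : ualg FT) : ueps X = cf (X : tcarrier T 1).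
Proof.
have := congr1 (@cf k T 0) (face0_ueps X).
by rewrite cf_face // com_elt_trident -[_ *: _]addr0 cf_lin cf_one mulr1 addr0.
Qed.

Section BinaryTrident.
Variables (X : ualg FT) (e : FT 2%N).
Local Notation ev2 e := (ev (e : tcarrier T 2) 0 1).

Lemma ev_pla : ev2 (pla X e) = lact (of_unary X) (ev2 e).
Proof. exact: (@ev_in_in k T 1 2 2 erefl 0 _ X e 0 1). Qed.

Lemma ev_pr1 : ev2 (pr1 e X) = ract1 (ev2 e) (of_unary X).
Proof. exact: (@ev_in_out k T 2 1 2 erefl 0 _ e X 0 1). Qed.

Lemma ev_pr2 : ev2 (pr2 e X) = ract2 (ev2 e) (of_unary X).
Proof. exact: (@ev_out_in k T 2 1 2 erefl 1 _ e X 0 0). Qed.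

End BinaryTrident.

Local Notation T' := (operad_trident trident_prim_neq0).
Let al : 'AHom(A, td_alg T') := linfun_ahom to_unary.
Let be : 'Hom(M, td_mod T') := linfun to_prim.

Let alE x : al x = to_unary x.
Proof. by rewrite lfunE. Qed.

Let beE mu : be mu = to_prim mu.
Proof. by rewrite lfunE. Qed.

Let al_eps x : td_eps T' (al x) = td_eps T x.
Proof. by rewrite alE lfunE /= ueps_trident. Qed.

Let restrE' (a : subvs_of (td_ideal T)) :
  vsval (@aug_restr k T T' al a) = to_unary (vsval a).
Proof. by rewrite (@aug_restrE k T T') // alE. Qed.

Let ev_tmod (mu : M) : ev (tmod mu) 0 1 = (0, 0, mu).
Proof. by rewrite /ev !av_tmod // mv_tmod. Qed.

Let ev_u : ev (com_elt FT 2 : tcarrier T 2) 0 1 = (1, 1, 0).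
Proof. by rewrite com_elt_trident ev_one. Qed.

Let mvE n (Y : tcarrier T n) t u : mv Y t u = (ev Y t u).2.
Proof. by []. Qed.

Let be_act mu s : be (td_act mu s) = td_act (be mu) s.
Proof.
rewrite !beE; apply: prim_trident_eq; rewrite to_primK gactE to_primE.
have [|] := perm2_cases s => ->.
  by rewrite op_act1 mv_tmod; case: (@td_actP _ T) => _ ->.
have := @ev_act k T 2 (tmod mu) (tperm ord0 ord_max) ord0 ord_max isT.
rewrite tpermL tpermR -(esw_ev (tmod mu)) [ev (tmod mu) _ _]ev_tmod => /(congr1 snd).
exact: esym.
Qed.

Let be_lact x mu : be (td_lact x mu) = td_lact (al x) (be mu).
Proof.
rewrite !beE alE; apply: prim_trident_eq.
rewrite to_primK glactE to_primE mvE ev_pla to_unaryK ev_tmod /=.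
by rewrite /aug linear0 scale0r !mlin subr0 !addr0.
Qed.

Let be_ract mu x y : be (td_ract mu x y) = td_ract (be mu) (al x) (al y).
Proof.
rewrite !beE !alE; apply: prim_trident_eq.
rewrite to_primK gractE to_primE mvE ev_pr2 ev_pr1 !to_unaryK ev_tmod /=.
by rewrite mul0r !mlin !addr0 ractE.
Qed.

Let be_f (a : subvs_of (td_ideal T)) : be (td_f a) = td_f (@aug_restr k T T' al a).
Proof.
rewrite !beE; apply: prim_trident_eq.
rewrite to_primK gfE restrE'.
have mvD (e e' : FT 2%N) : mv (e - e' : tcarrier T 2) 0 1 =
    mv (e : tcarrier T 2) 0 1 - mv (e' : tcarrier T 2) 0 1.
  by rewrite addrC -scaleN1r mv_lin scaleN1r addrC.
(* 1_2 is the triple (1, 1, 0): under [lact x] its component in M becomes [fA x + fA x - fA x], the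
   terms [gA 1 x] and [gA x 1] being 0, and under [ract1] and [ract2] it stays 0. *)
rewrite !mvD !mvE ev_pla ev_pr1 ev_pr2 !to_unaryK ev_u /=.
rewrite aug1 scale1r !(gA1l, gA1r) !mlin rl1 rr1 !addr0 !subr0 add0r addrK.
by rewrite /fA abar_vsval.
Qed.

Let be_g (a b : subvs_of (td_ideal T)) :
  be (td_g a b) = td_g (@aug_restr k T T' al a) (@aug_restr k T T' al b).
Proof.
rewrite !beE; apply: prim_trident_eq.
rewrite to_primK ggE !restrE' mvE ev_pr2 ev_pr1 !to_unaryK ev_u /=.
by rewrite gA1r !mlin !add0r mul1r /gA !abar_vsval.
Qed.

Definition trident_unit : trident_hom T T' :=
  @TridentHom k T T' al be al_eps be_act be_lact be_ract be_f be_g.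

Lemma trident_unit_iso : exists t' : trident_hom T' T,
  trident_hom_comp trident_unit t' = trident_hom_id T' /\
  trident_hom_comp t' trident_unit = trident_hom_id T.
Proof.
apply: (@trident_hom_inverse k T T' trident_unit of_unary
  (fun nu => mv (vsval nu : tcarrier T 2) 0 1)) => x.
- by rewrite [th_alg _ _]alE to_unaryK.
- by rewrite [th_alg _ _]alE of_unaryK.
- by rewrite [th_mod _ _]beE to_primK.
- by rewrite [th_mod _ _]beE to_primVK.
Qed.

End EssentiallySurjective.

Section Main.
Variables (R : realType) (k : fieldType).

Lemma operad3_prim_neq0 (P : comaug_operad3 R k) : prim P != 0%VS.
Proof.
have [x [x0 x1 xn0]] := GKdim3_primitive (c3_GKdim P).
apply: contraNneq xn0 => p0; rewrite -memv0 -p0; apply/primP.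
by split.
Qed.

Lemma trident_of_hom_id (P : comaug_operad3 R k) :
  trident_of_hom (operad3_prim_neq0 P) (operad3_prim_neq0 P) (comaug_hom_id P) =
  trident_hom_id (operad_trident (operad3_prim_neq0 P)).
Proof.
apply: trident_hom_ext => x //=; rewrite lfunE id_lfunE.
by apply: vsval_inj; rewrite /= hom_primE id_lfunE.
Qed.

Lemma trident_of_hom_comp (P Q S : comaug_operad3 R k)
    (g : comaug_hom Q S) (f : comaug_hom P Q) :
  trident_of_hom (operad3_prim_neq0 P) (operad3_prim_neq0 S) (comaug_hom_comp g f) =
  trident_hom_comp
    (trident_of_hom (operad3_prim_neq0 Q) (operad3_prim_neq0 S) g)
    (trident_of_hom (operad3_prim_neq0 P) (operad3_prim_neq0 Q) f).
Proof.
apply: trident_hom_ext => x /=; first by rewrite !comp_lfunE.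
rewrite comp_lfunE !lfunE; apply: vsval_inj; rewrite /= !hom_primE.
by rewrite comp_lfunE.
Qed.

Definition trident_functor : cat_functor (comaug_operad3_cat R k) (trident_cat k) :=
  @CatFunctor (comaug_operad3_cat R k) (trident_cat k)
    (fun P => operad_trident (operad3_prim_neq0 P))
    (fun P Q h => trident_of_hom (operad3_prim_neq0 P) (operad3_prim_neq0 Q) h)
    trident_of_hom_id trident_of_hom_comp.

End Main.

Theorem theorem0p2 (R : realType) (k : fieldType) :
  inhabited (equivalence (trident_cat k) (comaug_operad3_cat R k)).
Proof.
apply: (equivalence_of_ff_es (G := trident_functor R k)) => [P Q g g'|P Q h|T].
- by apply: trident_of_hom_inj; apply: (GKdim3_coskeletal (c3_GKdim _)).
- by apply: trident_of_hom_surj; apply: (GKdim3_coskeletal (c3_GKdim _)).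
- exists (trident_operad3 T R).
  (* The functor derives [prim != 0] from the dimension, the unit isomorphism from M; proofs of a
     boolean identity agree, so both give the same trident algebra. *)
  have -> : trident_functor R k (trident_operad3 T R) =
      operad_trident (trident_prim_neq0 T).
    have E : operad3_prim_neq0 (trident_operad3 T R) = trident_prim_neq0 T.
      exact: bool_irrelevance.
    exact: (congr1 (@operad_trident k (trident_comaug T)) E).
  have [t' [tt' t't]] := trident_unit_iso T.
  by exists (trident_unit T), t'.
Qed.
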